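(* Let $\{X_{i,n}\}_{1\le i\le n,\ n\ge1}$ be a triangular array such that for each $n$ the variables $X_{1,n},\dots,X_{n,n}$ are independent, $\mathbf{E}X_{i,n}=0$ for all $i\le n$, and $\sum_{i=1}^n\mathbf{E}X_{i,n}^2=1$. Let $g_{k,n}$, $1\le k\le n$, be deterministic real numbers. Assume that (a) $\max_{1\le k\le n}|g_{k,n}|\to0$ as $n\to\infty$; (b) $\mathbf{P}(T_n>n)>0$ for all $n\ge1$; (c) there is a deterministic sequence $r_n$ with $\max_{1\le i\le n}|X_{i,n}|\le r_n\to0$ as $n\to\infty$. Then $$\mathbf{P}(T_n>n)\sim\sqrt{\frac{2}{\pi}}\,E_n\qquad\text{as } n\to\infty .$$
   Context: $S_{k,n}:=X_{1,n}+\dots+X_{k,n}$; $T_n:=\inf\{k\ge1:\ S_{k,n}\le g_{k,n}\}$, so $\{T_n>n\}=\{S_{k,n}>g_{k,n}\text{ for all }1\le k\le n\}$; $E_n:=\mathbf{E}[S_{n,n}-g_{n,n};\,T_n>n]$, where $\mathbf{E}[Y;A]:=\mathbf{E}[Y\mathbf 1_A]$. The bound in (c) is understood almost surely. $a_n\sim b_n$ means $a_n/b_n\to1$. *)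

(* Defs.v *)
(* World: MathComp, with MathComp-Analysis *)
From HB Require Import structures.
From mathcomp Require Export all_boot all_order all_algebra.
From mathcomp Require Export all_classical all_reals all_analysis.

Set Implicit Arguments.
Unset Strict Implicit.
Unset Printing Implicit Defensive.

Export Order.TTheory GRing.Theory Num.Theory.
Export numFieldNormedType.Exports.

Local Open Scope classical_set_scope.
Local Open Scope ring_scope.

(* Mutual independence of the real random variables X 1, ..., X n: the product
   rule for every subfamily (J lists distinct indices) and all Borel sets. *)
Definition independent_row d (T : measurableType d) (R : realType)
    (P : probability T R) (n : nat) (X : nat -> {RV P >-> R}) : Prop :=
  forall (J : seq nat) (B : nat -> set R),
    uniq J -> {subset J <= index_iota 1 n.+1} ->
    (forall i, measurable (B i)) ->
    P (\bigcap_(i in [set` J]) (X i @^-1` B i)) =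
      (\prod_(i <- J) P (X i @^-1` B i))%E.

Definition row_sum (T : Type) (R : realType) (X : nat -> T -> R) (k : nat)
    (w : T) : R :=
  \sum_(1 <= i < k.+1) X i w.

(* First k with S_k <= g_k, as an extended real so that it is +oo when there is
   none.  The n-th row only provides S_k and g_k for k <= n. *)
Definition passage_time (T : Type) (R : realType) (n : nat) (X : nat -> T -> R)
    (g : nat -> R) (w : T) : \bar R :=
  ereal_inf [set k%:R%:E | k in
    [set k : nat | (1 <= k <= n)%N /\ row_sum X k w <= g k]].

Definition survival (T : Type) (R : realType) (n : nat) (X : nat -> T -> R)
    (g : nat -> R) : set T :=
  [set w | (n%:R%:E < passage_time n X g w)%E].

Definition expectation_on d (T : measurableType d) (R : realType)
    (P : probability T R) (Y : T -> R) (A : set T) : \bar R :=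
  'E_P[fun w => (Y w * \1_A w)%R]%E.

(* In the limit below a division by 0 gives 0, so the limit 1 forces v n != 0
   for all large n. *)
Definition asymp_equiv (R : realType) (u v : nat -> R) : Prop :=
  (fun n => u n / v n) @ \oo --> (1 : R).

(* Main.v *)
From HB Require Import structures.
Require Import Defs.
From mathcomp Require Import measurable_realfun ring lra.

(* Cut the paths at the first time they reach a small fixed height [h], far
   above the boundary and the increments.  Survival and the final excess
   [(S_n - g_n)^+] on survival are increasing in the increments, whereas "not
   reaching [h] before the clock shows [x]" is decreasing.  By Harris' inequality
   the latter paths carry at most the fraction [P(max S < h)] of [P(T_n > n)]
   and of [E_n], which is small when [h] is small with respect to [sqrt x].
   From a height close to [h], the mean excess is close to [h] because [S] is a
   martingale, and the survival probability is close to [sqrt (2 / pi) h]: the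
   odd solution [erf] of the heat equation, slightly shifted and smoothed, gives
   sub- and superharmonic functions up to an error proportional to the size of
   the increments.  Hence the ratio of the two quantities is close to
   [sqrt (2 / pi)], uniformly over the starting time and point of the cut path.
   Conditioning on the position at a given time is expressed by the backward
   recursion [survival_mean]. *)

Local Open Scope classical_set_scope.
Local Open Scope ring_scope.

Set Implicit Arguments.
Unset Strict Implicit.

Section taylor.
Variable R : realType.
Implicit Types (f df : R -> R) (a b B z w : R).

Lemma derive_bound_le f df a b B : a <= b ->
  (forall x : R, is_derive x 1 f (df x)) ->
  (forall x, a <= x <= b -> `|df x| <= B) ->
  `|f b - f a| <= B * (b - a).
Proof.
move=> ab fdf dfB.
have cf : {within `[a, b], continuous f}.
  apply: derivable_within_continuous => x _; exact: (@ex_derive _ _ _ _ _ _ _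
    (fdf x)).
have [c cab ->] := MVT_segment ab (fun x _ => fdf x) cf.
rewrite normrM (ger0_norm (_ : 0 <= b - a)) ?subr_ge0//.
by rewrite ler_wpM2r ?subr_ge0// dfB// (itvP cab).
Qed.

Lemma derive_bound f df a b B :
  (forall x : R, is_derive x 1 f (df x)) ->
  (forall x, Num.min a b <= x <= Num.max a b -> `|df x| <= B) ->
  `|f b - f a| <= B * `|b - a|.
Proof.
move=> fdf; have [ab|/ltW ab] := leP a b => dfB.
  by rewrite (ger0_norm (_ : 0 <= b - a)) ?subr_ge0//; exact: derive_bound_le.
rewrite distrC (distrC b) (ger0_norm (_ : 0 <= a - b)) ?subr_ge0//.
exact: derive_bound_le.
Qed.

Lemma derive_bound0 f df w B :
  (forall x : R, is_derive x 1 f (df x)) ->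
  (forall x, `|x| <= `|w| -> `|df x| <= B) ->
  f 0 = 0 -> `|f w| <= B * `|w|.
Proof.
move=> fdf dfB f0.
have := @derive_bound f df 0 w B fdf.
rewrite f0 !subr0; apply => x xw; apply: dfB.
rewrite ler_norml; case: (lerP 0 w) xw => w0 /andP[x1 x2].
  by rewrite (ger0_norm w0); lra.
by rewrite (ltr0_norm w0); lra.
Qed.

Lemma is_derive_translate f df a :
  (forall x : R, is_derive x 1 f (df x)) ->
  forall x : R, is_derive x 1 (fun y => f (a + y)) (df (a + x)).
Proof.
move=> fdf x; have h : is_derive x 1 (+%R a) 1.
  have : is_derive x 1 (cst a + id) (0 + 1) by apply: is_deriveD.
  by rewrite add0r.
have := fdf (a + x) => h'.
by apply: (is_derive_eq (is_derive1_comp h' h)); rewrite mulr1.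
Qed.

Lemma taylor2 f f1 f2 a w B :
  (forall x : R, is_derive x 1 f (f1 x)) -> (forall x : R, is_derive x 1 f1 (f2
    x)) ->
  (forall x, `|x| <= `|w| -> `|f2 (a + x)| <= B) ->
  `|f (a + w) - f a - w * f1 a| <= B * w ^+ 2.
Proof.
move=> df1 df2 f2B.
rewrite -(real_normK (num_real w)) expr2 mulrA.
have B1 : forall x, `|x| <= `|w| -> `|f1 (a + x) - f1 a| <= B * `|w|.
  move=> x xw; apply: (@le_trans _ _ (B * `|x|)).
    have h (y : R) : is_derive y 1 (fun y => f1 (a + y) - f1 a) (f2 (a + y)).
      have := is_derive_translate a df2 y => h1.
      by apply: is_derive_eq; rewrite subr0.
    apply: (@derive_bound0 (fun y => f1 (a + y) - f1 a) (fun y => f2 (a + y)))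
      => //.
      by move=> y yx; apply: f2B; exact: le_trans yx xw.
    by rewrite addr0 subrr.
  apply: ler_wpM2l => //; apply: le_trans (f2B 0 _); rewrite ?normr0//.
have h (y : R) : is_derive y 1 (fun y => f (a + y) - f a - y * f1 a) (f1 (a +
  y) - f1 a).
  have := is_derive_translate a df1 y => h1.
  apply: is_derive_eq.
  by rewrite subr0 /GRing.scale/= mulr0 add0r mulr1.
apply: (@derive_bound0 (fun y => f (a + y) - f a - y * f1 a)
   (fun y => f1 (a + y) - f1 a)) => //.
by rewrite addr0 subrr mul0r subr0.
Qed.

Lemma taylor3 f f1 f2 f3 a w B :
  (forall x : R, is_derive x 1 f (f1 x)) -> (forall x : R, is_derive x 1 f1 (f2
    x)) ->
  (forall x : R, is_derive x 1 f2 (f3 x)) ->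
  (forall x, `|f3 x| <= B) ->
  `|f (a + w) - f a - w * f1 a - w ^+ 2 / 2 * f2 a| <= B * `|w| ^+ 3.
Proof.
move=> df1 df2 df3 f3B.
have h (y : R) : is_derive y 1 (fun y => f (a + y) - f a - y * f1 a - y ^+ 2 /
  2 * f2 a)
   (f1 (a + y) - f1 a - y * f2 a).
  have := is_derive_translate a df1 y => h1.
  apply: is_derive_eq.
  by rewrite /GRing.scale/=; lra.
rewrite [_ ^+ 3]exprSr mulrA.
apply: (@derive_bound0 (fun y => f (a + y) - f a - y * f1 a - y ^+ 2 / 2 * f2
  a) _ _ _ h).
  move=> x xw; apply: le_trans (taylor2 df2 df3 (fun y _ => f3B (a + y))) _.
  rewrite -(real_normK (num_real x)).
  apply: ler_wpM2l; first exact: le_trans (f3B 0).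
  by rewrite lerXn2r// nnegrE.
by rewrite addr0 subrr; lra.
Qed.

End taylor.

Section gauss_primitive.
Variable R : realType.
Implicit Types x y z w : R.

Let mu : {measure set _ -> \bar R} := @lebesgue_measure R.

Definition gauss_primitive x : R :=
  \int[mu]_(t in `]-oo, x]) gauss_fun t - \int[mu]_(t in `]-oo, 0]) gauss_fun t.

Local Notation G := gauss_primitive.

Lemma is_derive_gauss_primitive x : is_derive x 1 G (gauss_fun x).
Proof.
have xx1 : x < x + 1 by rewrite ltrDl.
have [|||d1 d2] := @continuous_FTC1 R gauss_fun -oo%O x (x + 1) xx1.
- apply: integrableS (@integrableT_gauss R) => //.
- by rewrite ltNyr.
- exact: continuous_gauss_fun.
have h : is_derive x 1 (fun y => \int[mu]_(t in `]-oo, y]) gauss_fun t)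
  (gauss_fun x).
  by apply: DeriveDef; [exact: d1|rewrite -derive1E; exact: d2].
by apply: is_derive_eq; rewrite subr0.
Qed.

Lemma is_derive_gauss_fun x : is_derive x 1 (@gauss_fun R) (- 2 * x * gauss_fun
  x).
Proof.
have h : is_derive x 1 (fun y : R => - y ^+ 2) (- 2 * x).
  by apply: is_derive_eq; rewrite /GRing.scale/=; lra.
apply: is_derive_eq (is_derive1_comp (is_derive_expR _) h) _.
by rewrite mulrC.
Qed.

Lemma gauss_primitive0 : G 0 = 0.
Proof. by rewrite /G subrr. Qed.

Lemma gauss_primitiveN x : G (- x) = - G x.
Proof.
suff : G x + G (- x) = G 0 + G (- 0) by rewrite oppr0 gauss_primitive0; lra.
apply: (@is_derive_0_is_cst _ (fun x => G x + G (- x))) => y.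
have h1 := is_derive_gauss_primitive y.
have h2 : is_derive y 1 (G \o -%R) (gauss_fun (- y) * (- 1)).
  by apply: is_derive1_comp; exact: is_derive_gauss_primitive.
apply: is_derive_eq (is_deriveD h1 h2) _.
by rewrite /gauss_fun sqrrN; lra.
Qed.

Lemma le_gauss_primitive : {homo G : x y / x <= y}.
Proof.
move=> x y xy; rewrite -subr_ge0.
have [|c _ ->] := MVT_segment xy (fun x _ => is_derive_gauss_primitive x).
  apply: derivable_within_continuous => z _.
  exact: (@ex_derive _ _ _ _ _ _ _ (is_derive_gauss_primitive z)).
by rewrite mulr_ge0 ?gauss_fun_ge0 ?subr_ge0.
Qed.

Lemma gauss_primitive_ge0 x : 0 <= x -> 0 <= G x.
Proof. by rewrite -{2}gauss_primitive0; exact: le_gauss_primitive. Qed.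

Lemma gauss_primitive_le0 x : x <= 0 -> G x <= 0.
Proof. by rewrite -{2}gauss_primitive0; exact: le_gauss_primitive. Qed.

Lemma continuous_gauss_primitive : continuous G.
Proof.
move=> x; apply/differentiable_continuous/derivable1_diffP.
exact: (@ex_derive _ _ _ _ _ _ _ (is_derive_gauss_primitive x)).
Qed.

Lemma gauss_primitive_le_id x : 0 <= x -> G x <= x.
Proof.
move=> x0; rewrite -[leLHS]subr0 -gauss_primitive0.
have [|c _ ->] := MVT_segment x0 (fun x _ => is_derive_gauss_primitive x).
  exact/continuous_subspaceT/continuous_gauss_primitive.
by rewrite subr0 ler_piMl// gauss_fun_le1.
Qed.

Lemma gauss_primitive_ge x : 0 <= x -> x * (1 - x ^+ 2) <= G x.
Proof.
move=> x0; rewrite -[leRHS]subr0 -gauss_primitive0.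
have [|c cx ->] := MVT_segment x0 (fun x _ => is_derive_gauss_primitive x).
  exact/continuous_subspaceT/continuous_gauss_primitive.
rewrite subr0 mulrC ler_wpM2r//.
have := @expR_ge1Dx R (- c ^+ 2); rewrite -/(gauss_fun c); apply: le_trans.
rewrite lerD2l lerN2 lerXn2r ?nnegrE ?(itvP cx)//.
Qed.

Lemma gauss_primitive_sqr_cvg : G x ^+ 2 @[x --> +oo] --> (pi / 4 : R).
Proof.
apply: cvg_trans (@gauss_integral_proof.cvg_integral0_gauss_sqr R).
apply: near_eq_cvg; near=> x; congr (_ ^+ 2).
have x0 : 0 <= x by near: x; exact: nbhs_pinfty_ge.
rewrite /gauss_integral_proof.integral0_gauss /G.
rewrite (@Rintegral_itvB _ gauss_fun -oo%O (BRight x) 0)//; last first.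
  apply: integrableS (@integrableT_gauss R) => //.
rewrite Rintegral_itv_obnd_cbnd//.
apply: integrableS (@integrableT_gauss R) => //.
Unshelve. all: by end_near. Qed.

End gauss_primitive.

Section gauss_bounds.
Variable R : realType.
Implicit Types z w t rho : R.

Local Notation G := (@gauss_primitive R).
Local Notation gauss := (@gauss_fun R).

Lemma sqr_gauss_fun_le1 z : z ^+ 2 * gauss z <= 1.
Proof.
rewrite /gauss_fun expRN ler_pdivrMr ?expR_gt0// mul1r.
by apply: le_trans (expR_ge1Dx _); rewrite lerDr.
Qed.

Lemma norm_gauss_fun_le1 z : `|z * gauss z| <= 1.
Proof.
rewrite normrM (ger0_norm (gauss_fun_ge0 z)).
have h : `|z| <= (1 + z ^+ 2) / 2.
  by rewrite -(real_normK (num_real z)); have := sqr_ge0 (`|z| - 1); nra.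
apply: (@le_trans _ _ ((1 + z ^+ 2) / 2 * gauss z)).
  by rewrite ler_wpM2r ?gauss_fun_ge0.
by have := gauss_fun_le1 z; have := sqr_gauss_fun_le1 z; nra.
Qed.

Lemma cube_gauss_fun_le z : `|z ^+ 3 * gauss z| <= 3 / 2.
Proof.
have h4 : z ^+ 4 * gauss z <= 2.
  rewrite /gauss_fun expRN ler_pdivrMr ?expR_gt0//.
  have := @expR_ge1Dxn R (z ^+ 2) 1 (sqr_ge0 _).
  rewrite -exprM (_ : 2`!%:R = 2)//; lra.
rewrite normrM (ger0_norm (gauss_fun_ge0 z)) normrX.
have h : `|z| ^+ 3 <= (z ^+ 2 + z ^+ 4) / 2.
  rewrite -[z ^+ 2](real_normK (num_real z)) (_ : z ^+ 4 = `|z| ^+ 4);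
    last first.
    by rewrite -normrX ger0_norm// exprn_even_ge0.
  by have := sqr_ge0 (`|z| * (`|z| - 1)); nra.
apply: (@le_trans _ _ ((z ^+ 2 + z ^+ 4) / 2 * gauss z)).
  by rewrite ler_wpM2r ?gauss_fun_ge0.
by have := sqr_gauss_fun_le1 z; nra.
Qed.

Lemma gauss_primitive_shift z w rho : `|w| <= rho ->
  `|G (z + w) - G z - w * gauss z + w ^+ 2 * (z * gauss z)| <= 6 * rho * w ^+ 2.
Proof.
move=> wrho.
have d2 (x : R) : is_derive x 1 (fun y => - 2 * y * gauss y)
   ((- 2 + 4 * x ^+ 2) * gauss x).
  have h := is_derive_gauss_fun x.
  by apply: is_derive_eq; rewrite /GRing.scale/=; lra.
have := @taylor3 R G gauss _ _ z w 6 (@is_derive_gauss_primitive R)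
  (@is_derive_gauss_fun R) d2.
rewrite (_ : w ^+ 2 / 2 * _ = - (w ^+ 2 * (z * gauss z))); last lra.
rewrite opprK => /(_ _)/le_trans; apply.
  move=> x; rewrite ler_norml.
  have := gauss_fun_ge0 x; have := gauss_fun_le1 x; have := sqr_gauss_fun_le1 x.
  have : 0 <= x ^+ 2 * gauss x by rewrite mulr_ge0 ?sqr_ge0 ?gauss_fun_ge0.
  by move: (gauss x) => a; nra.
rewrite -(real_normK (num_real w)).
by have := normr_ge0 w; move: `|w| wrho => x xr x0; have := sqr_ge0 x; nra.
Qed.

Lemma gauss_primitive_dilate z t : 0 <= t <= 1 ->
  `|G (z / Num.sqrt (1 + 2 * t)) - G z + t * (z * gauss z)| <= 14 * t ^+ 2.
Proof.
move=> /andP[t0 t1].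
set s := Num.sqrt _.
have s0 : 0 < s by rewrite sqrtr_gt0; lra.
have s2 : s ^+ 2 = 1 + 2 * t by rewrite sqr_sqrtr; lra.
have s1 : 1 <= s by rewrite -(ler_pXn2r (n:=2)) ?nnegrE ?s2 ?expr1n ?(ltW
  s0)//; lra.
set l := s^-1.
have l0 : 0 < l by rewrite invr_gt0.
have l2 : l ^+ 2 * (1 + 2 * t) = 1 by rewrite -s2 exprVn mulVf ?expf_neq0
  ?gt_eqF.
have llo : 1 - t <= l.
  rewrite -(ler_pXn2r (n:=2)) ?nnegrE ?(ltW l0) ?subr_ge0//.
  have : (1 - t) ^+ 2 * (1 + 2 * t) <= 1 by nra.
  rewrite -[X in _ <= X -> _]l2 ler_pM2r//; lra.
have lhi : l <= 1 - t + 3 / 2 * t ^+ 2.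
  rewrite -(ler_pXn2r (n:=2)) ?nnegrE ?(ltW l0)//; last by nra.
  have : 1 <= (1 - t + 3 / 2 * t ^+ 2) ^+ 2 * (1 + 2 * t).
    rewrite [leRHS](_ : _ = 1 + t ^+ 3 * (5 - 15 / 4 * t + 9 / 2 * t ^+ 2));
      last by field.
    by rewrite lerDl mulr_ge0 ?exprn_ge0//; nra.
  rewrite -[X in X <= _ -> _]l2 ler_pM2r//; lra.
have l1 : l <= 1 by rewrite invf_le1.
have lh : 1 / 2 <= l.
  rewrite -(ler_pXn2r (n:=2)) ?nnegrE ?(ltW l0)//.
  have : (1 / 2) ^+ 2 * (1 + 2 * t) <= 1 by nra.
  rewrite -[X in _ <= X -> _]l2 ler_pM2r//; lra.
have d1 (x : R) : is_derive x 1 (fun y => G (y * z)) (z * gauss (x * z)).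
  have h1 : is_derive x 1 (fun y : R => y * z) z.
    by apply: is_derive_eq; rewrite /GRing.scale/=; lra.
  have h2 := is_derive_gauss_primitive (x * z).
  by rewrite mulrC; exact: (@is_derive1_comp _ G ( *%R^~ z) x _ _ h2 h1).
have d2 (x : R) : is_derive x 1 (fun y => z * gauss (y * z))
    (- 2 * x * z ^+ 3 * gauss (x * z)).
  have h1 : is_derive x 1 (fun y : R => y * z) z.
    by apply: is_derive_eq; rewrite /GRing.scale/=; lra.
  have h2 := is_derive_gauss_fun (x * z).
  have h3 : is_derive x 1 (fun y => gauss (y * z)) (- 2 * (x * z) * gauss (x *
    z) * z).
    exact: (@is_derive1_comp _ gauss ( *%R^~ z) x _ _ h2 h1).
  by apply: is_derive_eq; rewrite /GRing.scale/=; lra.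
have := @taylor2 R _ _ _ 1 (l - 1) 12 d1 d2.
rewrite (_ : 1 + (l - 1) = l) ?mul1r => [H|]; last by ring.
have {}H : `|G (l * z) - G z - (l - 1) * (z * gauss z)| <= 12 * (l - 1) ^+ 2.
  apply: H => x xl.
  have x1 : 1 / 2 <= 1 + x.
    move: xl; rewrite (_ : `|l - 1| = 1 - l); last by rewrite ler0_norm; lra.
    by rewrite ler_norml; lra.
  move: x1; set y := 1 + x => y1.
  have e : `|- 2 * y * z ^+ 3 * gauss (y * z)| * (y ^+ 2 / 2) <= 3 / 2.
    rewrite -[X in _ * X](@ger0_norm _ (y ^+ 2 / 2)) ?divr_ge0 ?sqr_ge0//.
    rewrite -normrM -normrN.
    rewrite (_ : - _ = (y * z) ^+ 3 * gauss (y * z)); last by field.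
    exact: cube_gauss_fun_le.
  have y2 : 1 / 4 <= y ^+ 2 by nra.
  by have := normr_ge0 (- 2 * y * z ^+ 3 * gauss (y * z)); nra.
rewrite (_ : _ + _ = (G (l * z) - G z - (l - 1) * (z * gauss z)) +
  (l - 1 + t) * (z * gauss z)); last by rewrite /l (mulrC _ z); ring.
rewrite (le_trans (ler_normD _ _))// normrM.
have : `|l - 1 + t| <= 3 / 2 * t ^+ 2 by rewrite ler_norml; nra.
have : (l - 1) ^+ 2 <= t ^+ 2 by nra.
have := norm_gauss_fun_le1 z; have := normr_ge0 (l - 1 + t).
by nra.
Qed.

Lemma gauss_primitive_le z : G z <= Num.sqrt pi / 2.
Proof.
have pi20 : 0 <= Num.sqrt pi / 2 :> R by rewrite divr_ge0.
have [z0|/ltW z0] := leP z 0; first exact: le_trans (gauss_primitive_le0 z0) _.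
rewrite -(ler_pXn2r (n:=2)) ?nnegrE ?gauss_primitive_ge0//.
rewrite expr_div_n sqr_sqrtr ?pi_ge0// (_ : 2 ^+ 2 = 4); last by ring.
have GR := @gauss_primitive_sqr_cvg R.
rewrite -(cvg_lim _ GR)//; apply: limr_ge; first by apply/cvg_ex;
  exists (pi / 4).
near=> x.
have zx : z <= x by near: x; apply: nbhs_pinfty_ge; exact: num_real.
by rewrite lerXn2r ?nnegrE ?gauss_primitive_ge0 ?(le_trans z0)//
  le_gauss_primitive.
Unshelve. all: by end_near. Qed.

Lemma gauss_primitive_near_limit t : 0 < t -> t < 1 ->
  exists2 z, 0 < z & (1 - t) * (Num.sqrt pi / 2) <= G z.
Proof.
move=> t0 t1.
have pi0 : 0 < Num.sqrt pi / 2 :> R by rewrite divr_gt0 ?sqrtr_gt0 ?pi_gt0.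
have : ((1 - t) * (Num.sqrt pi / 2)) ^+ 2 < pi / 4 :> R.
  rewrite exprMn expr_div_n sqr_sqrtr ?pi_ge0// (_ : 2 ^+ 2 = 4); last by ring.
  rewrite gtr_pMl ?divr_gt0 ?pi_gt0//; nra.
have /cvgr_gt Gpi := @gauss_primitive_sqr_cvg R.
move=> /Gpi H.
near (@pinfty_nbhs R) => z.
have z0 : 0 < z by near: z; apply: nbhs_pinfty_gt; exact: num_real.
exists z => //.
rewrite -(ler_pXn2r (n:=2)) ?nnegrE ?gauss_primitive_ge0 ?(ltW z0)//.
  by apply: ltW; near: z; exact: H.
by rewrite mulr_ge0 ?(ltW pi0)//; lra.
Unshelve. all: by end_near. Qed.

End gauss_bounds.

Section independence.
Context d (T : measurableType d) (R : realType) (P : probability T R).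

Lemma ge0_integral_indep d2 d3 (T2 : measurableType d2) (T3 : measurableType d3)
    (Z : {mfun T >-> T2}) (X : {mfun T >-> T3}) (f : T2 * T3 -> \bar R) :
  (forall A B, measurable A -> measurable B ->
    P (Z @^-1` A `&` X @^-1` B) = (P (Z @^-1` A) * P (X @^-1` B))%E) ->
  measurable_fun [set: T2 * T3] f -> (forall z, (0 <= f z)%E) ->
  (\int[P]_w f (Z w, X w) = \int[P]_w \int[P]_w' f (Z w, X w'))%E.
Proof.
move=> ZX mf f0.
have mZX : measurable_fun setT (fun w => (Z w, X w)).
  by apply/measurable_fun_pair.
pose mZX_mixin := isMeasurableFun.Build _ _ _ _ _ mZX.
pose ZXm : {mfun T >-> (T2 * T3)%type} := HB.pack (fun w => (Z w, X w))
  mZX_mixin.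
transitivity (\int[distribution P ZXm]_z f z)%E.
  by rewrite ge0_integral_pushforward.
transitivity (\int[(distribution P Z \x distribution P X)%E]_z f z)%E.
  apply: eq_measure_integral => A mA _.
  by apply/esym; apply: product_measure_unique => // B C mB mC; exact: ZX.
rewrite fubini_tonelli1//=; rewrite ge0_integral_pushforward//; last 2 first.
- exact: measurable_fun_fubini_tonelli_F.
- by move=> y _; exact: integral_ge0.
apply: eq_integral => w _ /=; rewrite /fubini_F ge0_integral_pushforward//.
exact: (measurable_fun_pair2 (Z w) mf).
Qed.

Lemma indep_g_sigma_algebra (C : set (set T)) (E : set T) :
  C `<=` measurable -> setI_closed C -> measurable E ->
  (forall A, C A -> P (A `&` E) = (P A * P E)%E) ->
  forall A, <<s C >> A -> P (A `&` E) = (P A * P E)%E.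
Proof.
move=> Cm CI mE CE A sA.
have PE : (P E = (fine (P E))%:E) by rewrite fineK// fin_num_measure.
have PE0 : 0 <= fine (P E) by rewrite fine_ge0.
pose m2 := mscale (NngNum PE0) P.
have mrE B : mrestr P mE B = P (B `&` E) by [].
have m2E B : m2 B = (P E * P B)%E by rewrite PE.
have H : forall A, <<s setT, [set X | C X /\ X `<=` setT] >> A ->
    mrestr P mE A = m2 A.
  apply: g_sigma_algebra_measure_unique_trace => //.
  - by move=> X [/Cm].
  - by move=> X Y [CX _] [CY _]; split => //; exact: CI.
  - by rewrite -[LHS]/(mrestr P mE _) mrE -[RHS]/(m2 _) m2E setTI
    probability_setT mule1.
  - move=> X [CX _]; rewrite -[LHS]/(mrestr P mE _) mrE -[RHS]/(m2 _) m2E.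
    by rewrite CE// muleC.
  - rewrite -[X in (X < _)%E]/(mrestr P mE _) mrE setTI.
    exact: le_lt_trans (probability_le1 P mE) (ltry _).
rewrite -mrE H ?m2E 1?muleC//.
suff -> : [set X | C X /\ X `<=` setT] = C by [].
by apply/seteqP; split => [X []|X].
Qed.

End independence.

Section locally_bounded.
Variable R : realType.
Implicit Types phi psi : R -> R.

Definition locally_bounded phi :=
  measurable_fun setT phi /\
  forall M : R, exists C : R, forall x, `|x| <= M -> `|phi x| <= C.

Lemma locally_bounded_continuous phi : continuous phi -> locally_bounded phi.
Proof.
move=> cphi; split; first exact: continuous_measurable_fun.
move=> M.
have cM : {within `[- M, M], continuous phi} by exact: continuous_subspaceT.
have := continuous_compact cM (@segment_compact _ _ _).
move=> /compact_bounded [C [_ HC]].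
exists (C + 1) => x xM; apply: (HC (C + 1)); first by rewrite ltrDl.
by exists x => //=; rewrite in_itv/= -ler_norml.
Qed.

Lemma locally_bounded_cst a : locally_bounded (fun=> a).
Proof. by split => // M; exists `|a|. Qed.

Lemma locally_boundedD phi psi : locally_bounded phi -> locally_bounded psi ->
  locally_bounded (fun x => phi x + psi x).
Proof.
move=> [mphi bphi] [mpsi bpsi]; split; first exact: measurable_funD.
move=> M; have [C1 h1] := bphi M; have [C2 h2] := bpsi M.
by exists (C1 + C2) => x xM; rewrite (le_trans (ler_normD _ _))// lerD// ?h1//
  h2.
Qed.

Lemma locally_boundedM phi psi : locally_bounded phi -> locally_bounded psi ->
  locally_bounded (fun x => phi x * psi x).
Proof.
move=> [mphi bphi] [mpsi bpsi]; split; first exact: measurable_funM.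
move=> M; have [C1 h1] := bphi M; have [C2 h2] := bpsi M.
by exists (C1 * C2) => x xM; rewrite normrM ler_pM// ?h1// h2.
Qed.

Lemma locally_boundedB phi psi : locally_bounded phi -> locally_bounded psi ->
  locally_bounded (fun x => phi x - psi x).
Proof.
move=> bphi bpsi.
have : locally_bounded (fun x => phi x + -1 * psi x).
  by apply: locally_boundedD => //; apply: locally_boundedM => //;
    exact: locally_bounded_cst.
by under eq_fun do rewrite mulN1r.
Qed.

Lemma locally_bounded_indic (B : set R) : measurable B -> locally_bounded (\1_B
  : R -> R).
Proof.
move=> mB; split; first exact: measurable_indic.
by move=> M; exists 1 => x _; rewrite indicE; case: (_ \in _);
  rewrite ?normr1 ?normr0.
Qed.

Lemma locally_bounded_id : locally_bounded (fun y : R => y).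
Proof. by apply: locally_bounded_continuous => y; exact: cvg_id. Qed.

Lemma locally_bounded_excess a : locally_bounded (fun y => Num.max 0 (y - a)).
Proof.
apply: locally_bounded_continuous => y.
apply: (@continuous_max _ _ (fun=> 0) (fun y => y - a)); first exact: cvg_cst.
by apply: cvgB; [exact: cvg_id|exact: cvg_cst].
Qed.

Lemma excess_ge0 (a y : R) : 0 <= Num.max 0 (y - a).
Proof. by rewrite le_max lexx. Qed.

Lemma measurable_gt (a : R) : measurable [set y : R | a < y].
Proof.
rewrite (_ : [set y | a < y] = `]a, +oo[%classic); first exact: measurable_itv.
by apply/seteqP; split => y /=; rewrite in_itv/= andbT.
Qed.

Lemma measurable_lt (a : R) : measurable [set y : R | y < a].
Proof.
have -> : [set y | y < a] = `]-oo, a[%classic.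
  by apply/seteqP; split => y /=; rewrite in_itv.
exact: measurable_itv.
Qed.

End locally_bounded.

Section shifted_mean_theory.
Context d (T : measurableType d) (R : realType) (P : probability T R).
Variables (X : T -> R) (e : R).
Hypotheses (mX : measurable_fun setT X) (Xe : forall w, `|X w| <= e).
Implicit Types (phi psi f g : R -> R) (s : R).

Definition shifted_mean phi s : R := \int[P]_w phi (s + X w).

Local Notation K := shifted_mean.

Lemma measurable_shift phi s : measurable_fun setT phi ->
  measurable_fun setT (fun w => phi (s + X w)).
Proof.
move=> mphi; apply: measurableT_comp => //.
by apply: measurable_funD => //; exact: measurable_cst.
Qed.

Lemma locally_bounded_integrable phi s : locally_bounded phi ->
  P.-integrable setT (EFin \o (fun w => phi (s + X w))).
Proof.
move=> [mphi bphi]; apply: measurable_bounded_integrable => //.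
- by rewrite (le_lt_trans (probability_le1 P _))// ltry.
- exact: measurable_shift.
- have [C HC] := bphi (`|s| + e).
  exists C; split; first exact: num_real.
  move=> y Cy w _ /=; rewrite (le_trans (HC _ _)) ?(ltW Cy)//.
  by rewrite (le_trans (ler_normD _ _))// lerD2l.
Qed.

Lemma shifted_mean_le phi psi s : locally_bounded phi -> locally_bounded psi ->
  (forall x, `|x| <= e -> phi (s + x) <= psi (s + x)) -> K phi s <= K psi s.
Proof.
move=> bphi bpsi h; apply: le_Rintegral => //;
  try exact: locally_bounded_integrable.
by move=> w _; exact: h.
Qed.

Lemma shifted_mean_cst a s : K (fun=> a) s = a.
Proof.
rewrite /shifted_mean Rintegral_cst// -[RHS]mulr1; congr (_ * _).
exact: (congr1 fine (probability_setT P)).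
Qed.

Lemma shifted_meanD phi psi s : locally_bounded phi -> locally_bounded psi ->
  K (fun y => phi y + psi y) s = K phi s + K psi s.
Proof. by move=> bphi bpsi; apply: RintegralD => //;
  exact: locally_bounded_integrable. Qed.

Lemma shifted_meanB phi psi s : locally_bounded phi -> locally_bounded psi ->
  K (fun y => phi y - psi y) s = K phi s - K psi s.
Proof. by move=> bphi bpsi; apply: RintegralB => //;
  exact: locally_bounded_integrable. Qed.

Lemma shifted_meanZ a phi s : locally_bounded phi ->
  K (fun y => a * phi y) s = a * K phi s.
Proof. by move=> bphi; apply: RintegralZl => //;
  exact: locally_bounded_integrable. Qed.

Lemma shifted_mean_ge0 phi s : (forall y, 0 <= phi y) -> 0 <= K phi s.
Proof. by move=> phi0; exact: Rintegral_ge0. Qed.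

Lemma shifted_mean_homo phi : locally_bounded phi ->
  {homo phi : x y / x <= y} -> {homo K phi : x y / x <= y}.
Proof.
move=> bphi nphi x y xy; apply: le_Rintegral => //;
  try exact: locally_bounded_integrable.
by move=> w _; apply: nphi; rewrite lerD2r.
Qed.

Lemma shifted_mean_nhomo phi : locally_bounded phi ->
  {homo phi : x y /~ x <= y} -> {homo K phi : x y /~ x <= y}.
Proof.
move=> bphi nphi x y xy; apply: le_Rintegral => //;
  try exact: locally_bounded_integrable.
by move=> w _; apply: nphi; rewrite lerD2r.
Qed.

Lemma EFin_shifted_mean phi s : locally_bounded phi ->
  ((K phi s)%:E = \int[P]_w (phi (s + X w))%:E)%E.
Proof.
move=> bphi; rewrite fineK//; apply: integrable_fin_num => //.
exact: locally_bounded_integrable.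
Qed.

Lemma locally_bounded_shifted_mean phi : locally_bounded phi ->
  (forall y, 0 <= phi y) -> locally_bounded (K phi).
Proof.
move=> bphi phi0; split.
  have mF : measurable_fun [set: R * T] (fun z => (phi (z.1 + X z.2))%:E).
    apply/measurable_EFinP; apply: measurableT_comp; first exact: (bphi.1).
    by apply: measurable_funD => //; exact: measurableT_comp.
  have h := @measurable_fun_fubini_tonelli_F _ _ _ _ R P _ mF.
  have {}h := h (fun z => phi0 _).
  exact: (measurableT_comp (@fine_measurable R setT measurableT) h).
move=> M; have [C HC] := (bphi.2) (M + e).
exists C => s sM; rewrite ger0_norm; last exact: shifted_mean_ge0.
rewrite -[leRHS](shifted_mean_cst C s); apply: shifted_mean_le => //.
  exact: locally_bounded_cst.
move=> x xe; rewrite (le_trans (ler_norm _))// HC//.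
by rewrite (le_trans (ler_normD _ _))// lerD.
Qed.

(* Integrate (f x - f y) * (g x - g y) <= 0 in x and then in y. *)
Lemma shifted_mean_chebyshev f g s : locally_bounded f -> locally_bounded g ->
  {homo f : x y / x <= y} -> {homo g : x y /~ x <= y} ->
  K (fun y => f y * g y) s <= K f s * K g s.
Proof.
move=> bf bg nf ng.
have bfg := locally_boundedM bf bg.
have h1 y : K (fun x => f x * g x) s + f y * g y <= f y * K g s + g y * K f s.
  rewrite -!shifted_meanZ// -[f y * g y](shifted_mean_cst _ s)
    -!shifted_meanD//;
    try exact: locally_bounded_cst;
    try by apply: locally_boundedM => //; exact: locally_bounded_cst.
  apply: shifted_mean_le.
  - by apply: locally_boundedD => //; exact: locally_bounded_cst.
  - by apply: locally_boundedD => //; apply: locally_boundedM => //;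
      exact: locally_bounded_cst.
  - move=> x _; have [xy|/ltW xy] := leP (s + x) y.
      by have := nf _ _ xy; have := ng _ _ xy; nra.
    by have := nf _ _ xy; have := ng _ _ xy; nra.
have : K (fun y => K (fun x => f x * g x) s + f y * g y) s <=
    K (fun y => f y * K g s + g y * K f s) s.
  apply: shifted_mean_le => // ; repeat (apply: locally_boundedD || apply:
    locally_boundedM) => //; exact: locally_bounded_cst.
rewrite !shifted_meanD//; try exact: locally_bounded_cst;
    try by apply: locally_boundedM => //; exact: locally_bounded_cst.
rewrite shifted_mean_cst.
under [X in _ <= X + _ -> _]eq_Rintegral do rewrite mulrC.
under [X in _ <= _ + X -> _]eq_Rintegral do rewrite mulrC.
rewrite [X in _ <= X + _ -> _](@shifted_meanZ (K g s))// [X in _ <= _ + X ->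
  _](@shifted_meanZ (K f s))//; lra.
Qed.

Variable v : R.
Hypotheses (EX : \int[P]_w X w = 0) (EX2 : \int[P]_w (X w ^+ 2) = v).

Lemma shifted_mean_quadratic phi s a b c D : locally_bounded phi ->
  (forall x, `|x| <= e -> `|phi (s + x) - (a + b * x + c * x ^+ 2)| <= D * x ^+
    2) ->
  `|K phi s - (a + c * v)| <= D * v.
Proof.
move=> bphi h.
pose q k y := a + b * (y - s) + k * (y - s) ^+ 2.
have bcst x := locally_bounded_cst (x : R).
have b1 : locally_bounded (fun y => y - s).
  by apply: locally_boundedB => //; exact: locally_bounded_id.
have b2 : locally_bounded (fun y => (y - s) ^+ 2) by exact: locally_boundedM.
have bq1 : locally_bounded (fun y => a + b * (y - s)).
  by apply: locally_boundedD => //; exact: locally_boundedM.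
have bq2 k : locally_bounded (fun y => k * (y - s) ^+ 2) by exact:
  locally_boundedM.
have bq k : locally_bounded (q k) by exact: locally_boundedD.
have K1 : K (fun y => y - s) s = 0.
  by rewrite -EX; apply: eq_Rintegral => w _; rewrite (addrC s) addrK.
have K2 : K (fun y => (y - s) ^+ 2) s = v.
  by rewrite -EX2; apply: eq_Rintegral => w _; rewrite (addrC s) addrK.
have Kq k : K (q k) s = a + k * v.
  rewrite shifted_meanD// shifted_meanD//; last exact: locally_boundedM.
  by rewrite shifted_mean_cst !shifted_meanZ// K1 K2 mulr0 addr0.
have : K phi s <= K (q (c + D)) s.
  apply: shifted_mean_le => // x /h; rewrite /q (addrC s) addrK ler_norml; lra.
have : K (q (c - D)) s <= K phi s.
  apply: shifted_mean_le => // x /h; rewrite /q (addrC s) addrK ler_norml; lra.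
by rewrite !Kq ler_norml; lra.
Qed.

End shifted_mean_theory.

Section killed_walk.
Context d (T : measurableType d) (R : realType) (P : probability T R).
Variables (X : nat -> T -> R) (e : R).
Hypotheses (mX : forall i, measurable_fun setT (X i))
  (Xe : forall i w, `|X i w| <= e).
Implicit Types (B C : nat -> set R) (phi psi : R -> R) (j k : nat) (s : R).

Local Notation K k := (shifted_mean P (X k)).
Local Notation S := (row_sum X).

Definition stays B k : set T :=
  [set w | forall i, (1 <= i <= k)%N -> B i (S i w)].

(* [survival_mean B psi j k s] is the mean of [psi] at time [k + j] over the
   paths that start from [s] at time [k] and are in [B i] at each time [i] with
   [k < i <= k + j]. *)
Fixpoint survival_mean B psi j k s : R :=
  if j is j'.+1 then
    K k.+1 (fun y => \1_(B k.+1) y * survival_mean B psi j' k.+1 y) s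
  else psi s.

Lemma row_sumS k w : S k.+1 w = S k w + X k.+1 w.
Proof. by rewrite /row_sum big_nat_recr. Qed.

Lemma row_sum0 w : S 0 w = 0.
Proof. by rewrite /row_sum big_nil. Qed.

Lemma staysS B k : stays B k.+1 = stays B k `&` [set w | B k.+1 (S k.+1 w)].
Proof.
apply/seteqP; split=> w /=.
  move=> h; split; last by apply: h; rewrite leqnn.
  by move=> i /andP[i1 ik]; apply: h; rewrite i1 ltnW.
move=> [h1 h2] i /andP[i1]; rewrite leq_eqVlt => /predU1P[->//|ik].
by apply: h1; rewrite i1.
Qed.

Lemma survival_mean_ge0 B psi j k s : (forall y, 0 <= psi y) ->
  0 <= survival_mean B psi j k s.
Proof.
move=> psi0; elim: j k s => [//|j IH] k s /=.
by apply: shifted_mean_ge0 => y; rewrite mulr_ge0.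
Qed.

Lemma locally_bounded_survival_mean B psi j k :
  (forall i, measurable (B i)) -> (forall y, 0 <= psi y) -> locally_bounded psi
    ->
  locally_bounded (survival_mean B psi j k).
Proof.
move=> mB psi0 bpsi; elim: j k => [//|j IH] k /=.
apply: locally_bounded_shifted_mean => //.
  by apply: locally_boundedM => //; exact: locally_bounded_indic.
by move=> y; rewrite mulr_ge0//; exact: survival_mean_ge0.
Qed.

Variable n : nat.
Hypothesis indep : forall (J : seq nat) (B : nat -> set R),
  uniq J -> {subset J <= index_iota 1 n.+1} ->
  (forall i, measurable (B i)) ->
  P (\bigcap_(i in [set` J]) (X i @^-1` B i)) =
    (\prod_(i <- J) P (X i @^-1` B i))%E.

Section past.
Variable k : nat.

Definition past_cylinders : set (set T) :=
  [set A | exists2 D : nat -> set R, (forall i, measurable (D i)) &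
    A = \bigcap_(i in [set` index_iota 1 k.+1]) X i @^-1` D i].

Lemma past_cylinders_measurable : past_cylinders `<=` measurable.
Proof.
move=> _ [D mD ->]; apply: bigcap_measurableType => i _.
by rewrite -[X in measurable X]setTI; exact: mX.
Qed.

Lemma past_cylinders_setI : setI_closed past_cylinders.
Proof.
move=> _ _ [D mD ->] [D' mD' ->].
exists (fun i => D i `&` D' i); first by move=> i; exact: measurableI.
by rewrite -bigcapI.
Qed.

Let past := g_sigma_algebraType past_cylinders.

Lemma measurable_past i : (1 <= i <= k)%N -> measurable_fun [set: past] (X i :
  past -> R).
Proof.
move=> ik _ B mB; rewrite setTI; apply: sub_sigma_algebra.
exists (fun j => if j == i then B else setT); first by move=> j; case: ifP.
apply/seteqP; split => w /=; first by move=> Bw j _; case: eqP => // ->.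
by move=> /(_ i); rewrite /= eqxx; apply; rewrite mem_index_iota ltnS.
Qed.

Lemma measurable_row_sum_past i : (i <= k)%N -> measurable_fun [set: past] (S i
  : past -> R).
Proof.
elim: i => [|i IH] ik.
  rewrite (_ : S 0 = cst 0); first exact: measurable_cst.
  by apply/funext => w; rewrite row_sum0.
rewrite (_ : S i.+1 = fun w => S i w + X i.+1 w); last first.
  by apply/funext => w; rewrite row_sumS.
apply: measurable_funD; first by apply: IH; exact: ltnW.
by apply: measurable_past; rewrite ik.
Qed.

Lemma measurable_stays_past B : (forall i, measurable (B i)) ->
  measurable (stays B k : set past).
Proof.
move=> mB.
rewrite (_ : stays B k = \bigcap_(i in [set i | (1 <= i <= k)%N]) (S i @^-1` B
  i))//.
apply: bigcap_measurableType => i /= /andP[i1 ik].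
rewrite -[X in measurable X]setTI.
exact: measurable_row_sum_past.
Qed.

Lemma indep_past A D : (k < n)%N -> <<s past_cylinders >> A -> measurable D ->
  P (A `&` X k.+1 @^-1` D) = (P A * P (X k.+1 @^-1` D))%E.
Proof.
move=> kn sA mD; apply: (indep_g_sigma_algebra _ past_cylinders_setI _ _ sA).
- exact: past_cylinders_measurable.
- by rewrite -[X in measurable X]setTI; exact: mX.
move=> _ [D' mD' ->].
pose D2 i := if i == k.+1 then D else D' i.
have mD2 i : measurable (D2 i) by rewrite /D2; case: ifP.
have kE i : i \in index_iota 1 k.+1 -> (i == k.+1) = false.
  by rewrite mem_index_iota => /andP[_ ik]; rewrite ltn_eqF.
have sub1 : {subset index_iota 1 k.+2 <= index_iota 1 n.+1}.
  by move=> i; rewrite !mem_index_iota => /andP[-> ik]; exact: leq_trans ik _.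
have sub2 : {subset index_iota 1 k.+1 <= index_iota 1 n.+1}.
  by move=> i; rewrite !mem_index_iota => /andP[-> ik];
    exact: leq_trans ik (ltnW _).
have u1 : uniq (index_iota 1 k.+2) by exact: iota_uniq.
have u2 : uniq (index_iota 1 k.+1) by exact: iota_uniq.
have := indep u1 sub1 mD2.
rewrite (big_nat_recr k.+1)//= => H.
rewrite (indep u2 sub2 mD').
transitivity (P (\bigcap_(i in [set` index_iota 1 k.+2]) X i @^-1` D2 i)).
  congr (P _); apply/seteqP; split => w /=.
    move=> [h1 h2] i /=; rewrite mem_index_iota => /andP[i1]; rewrite ltnS /D2.
    rewrite leq_eqVlt => /predU1P[->|ik]; first by rewrite eqxx.
    by rewrite ltn_eqF//; apply: h1; rewrite /= mem_index_iota i1.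
  move=> h; split.
    move=> i /= ik; have := h i; rewrite /D2 kE//; apply.
    by move: ik; rewrite /= !mem_index_iota => /andP[-> ik]; exact: ltnW.
  by have := h k.+1; rewrite /D2 eqxx; apply; rewrite /= mem_index_iota leqnn.
rewrite H; congr (_ * _)%E; last by rewrite /D2 eqxx.
by apply: eq_big_seq => i ik; rewrite /D2 kE.
Qed.

End past.

Lemma integral_staysS B phi k : (k < n)%N ->
  (forall i, measurable (B i)) -> (forall y, 0 <= phi y) -> locally_bounded phi
    ->
  (\int[P]_w (\1_(stays B k.+1) w * phi (S k.+1 w))%:E =
   \int[P]_w (\1_(stays B k) w * K k.+1 (fun y => \1_(B k.+1) y * phi y) (S k
     w))%:E)%E.
Proof.
move=> kn mB phi0 bphi.
pose past := g_sigma_algebraType (past_cylinders k).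
have mid : measurable_fun [set: T] (fun w : T => w : past).
  move=> _ A sA; rewrite setTI.
  apply: (smallest_sub _ (past_cylinders_measurable (k:=k)) sA).
  exact: sigma_algebra_measurable.
pose mid_mixin := isMeasurableFun.Build _ _ _ _ _ mid.
pose Z : {mfun T >-> past} := HB.pack (fun w : T => w : past) mid_mixin.
pose mX_mixin := isMeasurableFun.Build _ _ _ _ _ (mX k.+1).
pose Xk : {mfun T >-> R} := HB.pack (X k.+1) mX_mixin.
pose psi y := \1_(B k.+1) y * phi y.
have psi0 y : 0 <= psi y by rewrite mulr_ge0.
have bpsi : locally_bounded psi.
  by apply: locally_boundedM => //; exact: locally_bounded_indic.
pose f (z : past * R) := (\1_(stays B k) z.1 * psi (S k z.1 + z.2))%:E.
have mf : measurable_fun [set: past * R] f.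
  apply/measurable_EFinP; apply: measurable_funM.
    apply: (@measurableT_comp _ _ _ _ _ _ (\1_(stays B k) : past -> R)) => //.
    by apply: measurable_indic; exact: measurable_stays_past.
  apply: measurableT_comp; first exact: bpsi.1.
  apply: measurable_funD => //.
  apply: (@measurableT_comp _ _ _ _ _ _ (S k : past -> R)) => //.
  exact: measurable_row_sum_past.
have := @ge0_integral_indep _ _ _ P _ _ _ _ Z Xk f _ mf _.
move=> /(_ _ _)/= H.
transitivity (\int[P]_w f (w, X k.+1 w))%E.
  apply: eq_integral => w _; congr EFin; rewrite /f/= /psi mulrA -row_sumS;
    congr (_ * _).
  by rewrite staysS !indicE in_setI -natrM mulnb.
rewrite H.
- apply: eq_integral => w _.
  rewrite EFinM (@EFin_shifted_mean _ _ _ P _ e (mX k.+1) (Xe k.+1))//.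
  rewrite -ge0_integralZl//=; last 2 first.
  - by apply/measurable_EFinP; exact: (measurable_shift (mX k.+1) (S k w)
    bpsi.1).
  - by move=> x _; rewrite lee_fin; exact: psi0.
- by move=> A D sA mD; exact: indep_past.
- by move=> z; rewrite lee_fin mulr_ge0.
Qed.

Lemma integral_stays B psi j k : (k + j <= n)%N ->
  (forall i, measurable (B i)) -> (forall y, 0 <= psi y) -> locally_bounded psi
    ->
  (\int[P]_w (\1_(stays B (k + j)) w * psi (S (k + j) w))%:E =
   \int[P]_w (\1_(stays B k) w * survival_mean B psi j k (S k w))%:E)%E.
Proof.
move=> + mB psi0 bpsi; elim: j k => [|j IH] k; first by rewrite addn0.
rewrite addnS -addSn => kj; rewrite IH// integral_staysS//.
- exact: leq_trans (leq_addr _ _) kj.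
- by move=> y; exact: survival_mean_ge0.
- exact: locally_bounded_survival_mean.
Qed.

Lemma integral_survival_mean B psi :
  (forall i, measurable (B i)) -> (forall y, 0 <= psi y) -> locally_bounded psi
    ->
  (\int[P]_w (\1_(stays B n) w * psi (S n w))%:E = (survival_mean B psi n 0
    0)%:E)%E.
Proof.
move=> mB psi0 bpsi; have := @integral_stays B psi n 0 (leqnn _) mB psi0 bpsi.
rewrite add0n => ->.
under eq_integral => w _.
  rewrite row_sum0 (_ : \1_(stays B 0) w = 1) ?mul1r; last first.
    by rewrite indicE mem_set// => i /andP[/leq_trans h /h].
  over.
by rewrite integral_cst// [X in (_ * X)%E](probability_setT P) mule1.
Qed.

End killed_walk.

Section comparison.
Context d (T : measurableType d) (R : realType) (P : probability T R).
Variables (X : nat -> T -> R) (e : R).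
Hypotheses (mX : forall i, measurable_fun setT (X i))
  (Xe : forall i w, `|X i w| <= e).
Implicit Types (B C : nat -> set R) (phi psi : R -> R) (j k : nat) (s : R).

Local Notation K k := (shifted_mean P (X k)).
Local Notation sm := (survival_mean P X).

Let bcst (a : R) := @locally_bounded_cst R a.

Lemma bound_ge0 : 0 <= e.
Proof. by apply: le_trans (Xe 0 point). Qed.

Lemma le_indic (A : set R) (x y : R) : (A x -> A y) -> \1_A x <= \1_A y :> R.
Proof.
rewrite !indicE => Axy; have [/set_mem/Axy Ay|_] := boolP (x \in A);
  last by rewrite ler0n.
by rewrite mem_set.
Qed.

Lemma locally_bounded_killed B psi j k i :
  (forall i, measurable (B i)) -> (forall y, 0 <= psi y) -> locally_bounded psi
    ->
  locally_bounded (fun y => \1_(B i) y * sm B psi j k y).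
Proof.
move=> mB psi0 bpsi; apply: locally_boundedM.
  exact: locally_bounded_indic.
exact: (locally_bounded_survival_mean P mX Xe).
Qed.

Lemma survival_mean_cst B c j k s : (forall i, measurable (B i)) ->
  sm B (fun=> c) j k s = c * sm B (fun=> 1) j k s.
Proof.
move=> mB; elim: j k s => [|j IH] k s /=; first by rewrite mulr1.
rewrite -(shifted_meanZ P (mX _) (Xe _))//; last exact: locally_bounded_killed.
by apply: eq_Rintegral => w _; rewrite IH mulrCA.
Qed.

Lemma survival_mean_le1 B j k s : (forall i, measurable (B i)) ->
  sm B (fun=> 1) j k s <= 1.
Proof.
move=> mB; elim: j k s => [//|j IH] k s /=.
rewrite -[leRHS](shifted_mean_cst P (X k.+1) 1 s).
apply: (shifted_mean_le P (mX _) (Xe _)) => //;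
  first exact: locally_bounded_killed.
by move=> x _; rewrite -[leRHS]mul1r ler_pM ?survival_mean_ge0// indicE lern1
  leq_b1.
Qed.

Lemma survival_mean_homo B psi j k : (forall i, measurable (B i)) ->
  (forall i x y, x <= y -> B i x -> B i y) ->
  (forall y, 0 <= psi y) -> locally_bounded psi -> {homo psi : x y / x <= y} ->
  {homo sm B psi j k : x y / x <= y}.
Proof.
move=> mB uB psi0 bpsi npsi; elim: j k => [//|j IH] k /=.
apply: (shifted_mean_homo P (mX _) (Xe _)); first exact: locally_bounded_killed.
by move=> x y xy; rewrite ler_pM ?survival_mean_ge0 ?IH// le_indic//; exact: uB.
Qed.

Lemma survival_mean_nhomo C j k : (forall i, measurable (C i)) ->
  (forall i x y, x <= y -> C i y -> C i x) ->
  {homo sm C (fun=> 1) j k : x y /~ x <= y}.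
Proof.
move=> mC dC; elim: j k => [|j IH] k /=; first by move=> *.
apply: (shifted_mean_nhomo P (mX _) (Xe _)); first exact:
  locally_bounded_killed.
by move=> x y xy; rewrite ler_pM ?survival_mean_ge0 ?IH// le_indic//; exact: dC.
Qed.

Lemma survival_mean_harris B C psi j k s :
  (forall i, measurable (B i)) -> (forall i, measurable (C i)) ->
  (forall i x y, x <= y -> B i x -> B i y) ->
  (forall i x y, x <= y -> C i y -> C i x) ->
  (forall y, 0 <= psi y) -> locally_bounded psi -> {homo psi : x y / x <= y} ->
  sm (fun i => B i `&` C i) psi j k s <= sm B psi j k s * sm C (fun=> 1) j k s.
Proof.
move=> mB mC uB dC psi0 bpsi npsi; elim: j k s => [|j IH] k s /=.
  by rewrite mulr1.
have mBC i : measurable (B i `&` C i) by exact: measurableI.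
apply: le_trans (shifted_mean_chebyshev P (mX _) (Xe _) s _ _ _ _);
  last 4 first.
- exact: locally_bounded_killed.
- exact: locally_bounded_killed.
- move=> x y xy; rewrite ler_pM ?survival_mean_ge0//.
    by rewrite le_indic//; exact: uB.
  exact: survival_mean_homo.
- move=> x y xy; rewrite ler_pM ?survival_mean_ge0//.
    by rewrite le_indic//; exact: dC.
  exact: survival_mean_nhomo.
apply: (shifted_mean_le P (mX _) (Xe _)).
- exact: locally_bounded_killed.
- by apply: locally_boundedM; exact: locally_bounded_killed.
by move=> x _; rewrite indicI mulrACA ler_wpM2l.
Qed.

Lemma survival_mean_le B psi (F : nat -> R -> R) (D : nat -> set R) N j0 :
  (forall i, measurable (B i)) -> (forall y, 0 <= psi y) -> locally_bounded psi
    ->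
  (forall k, locally_bounded (F k)) ->
  (forall s, D N s -> sm B psi j0 N s <= F N s) ->
  (forall k s x, (k < N)%N -> D k s -> `|x| <= e -> B k.+1 (s + x) ->
    D k.+1 (s + x)) ->
  (forall k s x, (k < N)%N -> D k s -> `|x| <= e -> 0 <= F k.+1 (s + x)) ->
  (forall k s, (k < N)%N -> D k s -> K k.+1 (F k.+1) s <= F k s) ->
  forall j k s, (k + j = N)%N -> D k s -> sm B psi (j + j0) k s <= F k s.
Proof.
move=> mB psi0 bpsi bF FN DS F0 FS; elim=> [|j IH] k s.
  by rewrite addn0 => ->; exact: FN.
rewrite addnS -addSn => kj Dk; rewrite addSn /=.
have kN : (k < N)%N by rewrite -kj addSn ltnS leq_addr.
apply: le_trans (FS _ _ kN Dk).
apply: (shifted_mean_le P (mX _) (Xe _)) => //;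
  first exact: locally_bounded_killed.
move=> x xe; rewrite indicE; have [/set_mem Bx|_] := boolP (_ \in _).
  by rewrite mul1r IH//; exact: DS Bx.
by rewrite mul0r; exact: F0 xe.
Qed.

Lemma survival_mean_ge B psi (F : nat -> R -> R) N :
  (forall i, measurable (B i)) -> (forall y, 0 <= psi y) -> locally_bounded psi
    ->
  (forall k, locally_bounded (F k)) ->
  (forall s, F N s <= psi s) ->
  (forall k y, (k < N)%N -> ~ B k.+1 y -> F k.+1 y <= 0) ->
  (forall k s, (k < N)%N -> F k s <= K k.+1 (F k.+1) s) ->
  forall j k s, (k + j = N)%N -> F k s <= sm B psi j k s.
Proof.
move=> mB psi0 bpsi bF FN F0 FS; elim=> [|j IH] k s.
  by rewrite addn0 => ->; exact: FN.
rewrite addnS -addSn => kj /=.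
have kN : (k < N)%N by rewrite -kj addSn ltnS leq_addr.
apply: le_trans (FS _ _ kN) _.
apply: (shifted_mean_le P (mX _) (Xe _)) => //;
  first exact: locally_bounded_killed.
move=> x xe; rewrite indicE; have [/set_mem Bx|/negP Bx] := boolP (_ \in _).
  by rewrite mul1r IH.
by rewrite mul0r; apply: F0 => // /mem_set.
Qed.

Lemma eq_survival_mean_after B B' psi j k s :
  (forall i, (k < i)%N -> B i = B' i) -> sm B psi j k s = sm B' psi j k s.
Proof.
elim: j k s => [//|j IH] k s BB' /=.
apply: eq_Rintegral => w _; rewrite BB'// IH// => i ki; apply: BB'.
exact: ltn_trans ki.
Qed.

(* Decomposition at the first passage above [h], for the paths reaching [h]
   before time [m]. *)
Lemma survival_mean_passage_le B C psi1 psi2 (h b : R) m j0 :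
  (forall i, measurable (B i)) ->
  (forall i, C i = if (i <= m)%N then [set y | y < h] else setT) ->
  (forall y, 0 <= psi1 y) -> locally_bounded psi1 ->
  (forall y, 0 <= psi2 y) -> locally_bounded psi2 ->
  (forall j k s, (k + j = m)%N -> h <= s <= h + e ->
    sm B psi1 (j + j0) k s <= b * sm B psi2 (j + j0) k s) ->
  let BC i := B i `&` C i in
  forall j k s, (k + j = m)%N -> s < h ->
    sm B psi1 (j + j0) k s - sm BC psi1 (j + j0) k s <=
    b * (sm B psi2 (j + j0) k s - sm BC psi2 (j + j0) k s).
Proof.
move=> mB CE psi10 bpsi1 psi20 bpsi2 Bh BC.
have mC i : measurable (C i).
  by rewrite CE; case: ifP => _ //; exact: measurable_lt.
have mBC i : measurable (BC i) by exact: measurableI.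
elim=> [|j IH] k s.
  rewrite addn0 => -> sh.
  have BCE psi : sm BC psi (0 + j0) m s = sm B psi (0 + j0) m s.
    by apply: eq_survival_mean_after => i mi; rewrite /BC CE leqNgt mi/= setIT.
  by rewrite !BCE !subrr mulr0.
rewrite addnS -addSn => kj sh; rewrite addSn /=.
have km : (k < m)%N by rewrite -kj addSn ltnS leq_addr.
pose D psi y := \1_(B k.+1) y * sm B psi (j + j0) k.+1 y -
  \1_(BC k.+1) y * sm BC psi (j + j0) k.+1 y.
have bD psi : (forall y, 0 <= psi y) -> locally_bounded psi -> locally_bounded
  (D psi).
  by move=> psi0 bpsi; apply: locally_boundedB; exact: locally_bounded_killed.
rewrite -!(shifted_meanB P (mX _) (Xe _)); try exact: locally_bounded_killed.
rewrite -/(D psi1) -/(D psi2).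
rewrite -(shifted_meanZ P (mX _) (Xe _)); last exact: bD.
apply: (shifted_mean_le P (mX _) (Xe _)); first exact: bD.
  by apply: locally_boundedM; [exact: bcst|exact: bD].
move=> x xe; set y := s + x; rewrite /D.
have -> : \1_(BC k.+1) y = \1_(B k.+1) y * (y < h)%R%:R :> R.
  rewrite !indicE in_setI -natrM mulnb; congr ((_ && _)%:R).
  by rewrite CE km/=; apply/idP/idP; rewrite inE.
have [yh|yh] := ltP y h.
  rewrite mulr1 -!mulrBr mulrCA ler_wpM2l//.
  exact: IH.
rewrite mulr0 !mul0r !subr0 mulrCA ler_wpM2l//.
apply: Bh => //; rewrite yh /y lerD ?(ltW sh)//.
by rewrite (le_trans (ler_norm _)).
Qed.

End comparison.

Section gauss_mean.
Context d (T : measurableType d) (R : realType) (P : probability T R).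
Variables (X : T -> R) (e v : R).
Hypotheses (mX : measurable_fun setT X) (Xe : forall w, `|X w| <= e).
Hypotheses (EX : \int[P]_w X w = 0) (EX2 : \int[P]_w (X w ^+ 2) = v).

Local Notation G := (@gauss_primitive R).

Lemma second_moment_bounds : 0 <= v <= e ^+ 2.
Proof.
rewrite -EX2; apply/andP; split; first by apply: Rintegral_ge0 => w _;
  exact: sqr_ge0.
rewrite -[leRHS](shifted_mean_cst P X _ 0).
rewrite (_ : \int[P]_w (X w ^+ 2) = shifted_mean P X (fun y => y ^+ 2) 0);
  last first.
  by apply: eq_Rintegral => w _; rewrite add0r.
apply: (shifted_mean_le P mX Xe).
- apply: locally_bounded_continuous; exact: exprn_continuous.
- exact: locally_bounded_cst.
- move=> x xe; rewrite add0r -(real_normK (num_real x)) lerXn2r ?nnegrE//.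
  exact: le_trans xe.
Qed.

Lemma locally_bounded_gauss_primitive c V :
  locally_bounded (fun y : R => G ((y + c) / V)).
Proof.
apply: locally_bounded_continuous => y.
apply: (@continuous_comp _ _ _ (fun y : R => (y + c) / V) G); last first.
  exact: continuous_gauss_primitive.
by apply: cvgM; [apply: cvgD; [exact: cvg_id|exact: cvg_cst]|exact: cvg_cst].
Qed.

(* [G (y / sqrt V)] solves the heat equation in [V], so that averaging it over a
   small step of variance [v] amounts to adding [2 * v] to [V]. *)
Lemma gauss_mean V c s : 0 < V -> e ^+ 2 <= V ->
  `|shifted_mean P X (fun y => G ((y + c) / Num.sqrt V)) s -
    G ((s + c) / Num.sqrt (V + 2 * v))| <= 20 * e * v / Num.sqrt V ^+ 3.
Proof.
move=> V0 eV.
have e0 : 0 <= e by exact: le_trans (Xe point).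
have /andP[v0 ve] := second_moment_bounds.
set q := Num.sqrt V.
have q0 : 0 < q by rewrite sqrtr_gt0.
have q2 : q ^+ 2 = V by rewrite sqr_sqrtr// ltW.
have eq : e <= q by rewrite -(ler_pXn2r (n:=2)) ?nnegrE ?(ltW q0)// q2.
pose z := (s + c) / q; pose tau := v / V.
have tauV : tau * V = v by rewrite /tau divfK// gt_eqF.
have tau0 : 0 <= tau by rewrite divr_ge0// ltW.
have tau1 : tau <= 1 by rewrite ler_pdivrMr// mul1r (le_trans ve).
have H1 : `|shifted_mean P X (fun y => G ((y + c) / q)) s -
    (G z + - (z * gauss_fun z / V) * v)| <= 6 * e / q / V * v.
  apply: (shifted_mean_quadratic mX Xe EX EX2 (b := gauss_fun z / q)).
    exact: locally_bounded_gauss_primitive.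
  move=> x xe.
  have xq : `|x / q| <= e / q.
    by rewrite normrM (ger0_norm (_ : 0 <= q^-1)) ?invr_ge0 ?(ltW q0)//
      ler_pM2r ?invr_gt0.
  have := gauss_primitive_shift z xq.
  have -> : z + x / q = (s + x + c) / q by rewrite /z; field; rewrite gt_eqF.
  rewrite (_ : 6 * (e / q) * (x / q) ^+ 2 = 6 * e / q / V * x ^+ 2); last first.
    by rewrite -q2; field; rewrite gt_eqF.
  apply: le_trans; rewrite le_eqVlt; apply/orP; left; apply/eqP; congr (`| _ |).
  by rewrite -q2; field; rewrite gt_eqF.
have H2 := @gauss_primitive_dilate R z tau _.
have {}H2 : `|G (z / Num.sqrt (1 + 2 * tau)) - G z + tau * (z * gauss_fun z)| <=
    14 * tau ^+ 2 by apply: H2; rewrite tau0.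
have zE : z / Num.sqrt (1 + 2 * tau) = (s + c) / Num.sqrt (V + 2 * v).
  rewrite /z -mulrA -invfM; congr (_ / _).
  rewrite -sqrtrM ?(ltW V0)// -tauV; congr Num.sqrt; ring.
rewrite zE in H2.
have H3 : 6 * e / q / V * v + 14 * tau ^+ 2 <= 20 * e * v / q ^+ 3.
  have -> : 6 * e / q / V * v = 6 * (e / q) * tau.
    by rewrite /tau; field; rewrite !gt_eqF.
  have -> : 20 * e * v / q ^+ 3 = 20 * (e / q) * tau.
    by rewrite /tau -q2; field; rewrite gt_eqF.
  have : tau <= e / q.
    rewrite /tau -q2 (@le_trans _ _ ((e / q) ^+ 2))//.
      by rewrite expr_div_n ler_pM2r// invr_gt0 exprn_gt0.
    have : 0 <= e / q by rewrite divr_ge0// ltW.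
    have : e / q <= 1 by rewrite ler_pdivrMr// mul1r.
    by move: (e / q) => r; nra.
  by move: (e / q) tau0 => r; nra.
have E1 : z * gauss_fun z / V * v = tau * (z * gauss_fun z).
  by rewrite /tau; field; rewrite gt_eqF.
apply: le_trans (ler_distD (G z - tau * (z * gauss_fun z)) _ _) (le_trans _ H3).
apply: lerD; first by move: H1; rewrite mulNr E1.
by rewrite distrC opprB addrA addrAC.
Qed.

End gauss_mean.

Section survival_bounds.
Context d (T : measurableType d) (R : realType) (P : probability T R).
Variables (X : nat -> T -> R) (e : R) (n : nat) (v : nat -> R).
Hypotheses (mX : forall i, measurable_fun setT (X i))
  (Xe : forall i w, `|X i w| <= e).
Hypotheses (EX : forall i, (1 <= i <= n)%N -> \int[P]_w X i w = 0)
  (EX2 : forall i, (1 <= i <= n)%N -> \int[P]_w (X i w ^+ 2) = v i).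
Implicit Types (j k m N : nat) (s c : R).

Local Notation K k := (shifted_mean P (X k)).
Local Notation sm := (survival_mean P X).
Local Notation G := (@gauss_primitive R).
Local Notation Goo := (Num.sqrt pi / 2 : R).

Definition clock k : R := \sum_(1 <= i < k.+1) v i.

Lemma clockS k : clock k.+1 = clock k + v k.+1.
Proof. by rewrite /clock big_nat_recr. Qed.

Lemma clock0 : clock 0 = 0.
Proof. by rewrite /clock big_nil. Qed.

Lemma step_variance_bounds i : (1 <= i <= n)%N -> 0 <= v i <= e ^+ 2.
Proof. by move=> i1n; exact: (second_moment_bounds (mX i) (Xe i) (EX2 i1n)).
  Qed.

Lemma le_clock k N : (k <= N)%N -> (N <= n)%N -> clock k <= clock N.
Proof.
elim: N => [|N IH]; first by rewrite leqn0 => /eqP->.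
rewrite leq_eqVlt => /predU1P[->//|kN Nn].
apply: le_trans (IH kN (ltnW Nn)) _; rewrite clockS lerDl.
by have /andP[] := step_variance_bounds (Nn : (1 <= N.+1 <= n)%N).
Qed.

Section barrier.
Variables (sg : R) (N : nat).
Hypotheses (sg0 : 0 < sg) (esg : e <= sg) (Nn : (N <= n)%N).

Definition barrier c k s : R :=
  G ((s + c) / Num.sqrt (2 * (clock N - clock k) + sg ^+ 2)).

Definition barrier_error k : R := 20 * e / sg ^+ 3 * (clock N - clock k).

Lemma barrier_step c k s : (k < N)%N ->
  `|K k.+1 (barrier c k.+1) s - barrier c k s| <=
    barrier_error k - barrier_error k.+1.
Proof.
move=> kN.
have k1n : (1 <= k.+1 <= n)%N by rewrite /= (leq_trans kN).
have /andP[v0 ve] := step_variance_bounds k1n.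
set V := 2 * (clock N - clock k.+1) + sg ^+ 2.
have sgV : sg ^+ 2 <= V by rewrite lerDr mulr_ge0// subr_ge0 le_clock.
have e0 : 0 <= e := bound_ge0 Xe.
have V0 : 0 < V by rewrite (lt_le_trans _ sgV)// exprn_gt0.
have eV : e ^+ 2 <= V by rewrite (le_trans _ sgV)// lerXn2r// nnegrE// ltW.
have := gauss_mean (mX k.+1) (Xe k.+1) (EX k1n) (EX2 k1n) c s V0 eV.
have -> : V + 2 * v k.+1 = 2 * (clock N - clock k) + sg ^+ 2.
  by rewrite /V clockS; ring.
move=> /le_trans; apply.
have -> : barrier_error k - barrier_error k.+1 = 20 * e * v k.+1 / sg ^+ 3.
  by rewrite /barrier_error clockS; ring.
have qV : sg <= Num.sqrt V.
  by rewrite -(ler_pXn2r (n:=2)) ?nnegrE ?(ltW sg0) ?sqrtr_ge0// sqr_sqrtr//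
    ltW.
rewrite ler_wpM2l ?mulr_ge0// lef_pV2 ?posrE ?exprn_gt0 ?(lt_le_trans sg0)//.
by rewrite lerXn2r ?nnegrE ?sqrtr_ge0 ?(ltW sg0).
Qed.

Lemma barrier_error_ge0 k : (k <= N)%N -> 0 <= barrier_error k.
Proof.
move=> kN; rewrite mulr_ge0 ?divr_ge0 ?mulr_ge0 ?(bound_ge0 Xe) ?exprn_ge0
  ?(ltW sg0)//.
by rewrite subr_ge0 le_clock.
Qed.

Lemma barrier_end c s : barrier c N s = G ((s + c) / sg).
Proof. by rewrite /barrier subrr mulr0 add0r sqrtr_sqr gtr0_norm. Qed.

Lemma barrier_error_end : barrier_error N = 0.
Proof. by rewrite /barrier_error subrr mulr0. Qed.

Lemma locally_bounded_barrier c k : locally_bounded (barrier c k).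
Proof. exact: locally_bounded_gauss_primitive. Qed.

Lemma barrier_ge0 c k s : 0 <= s + c -> 0 <= barrier c k s.
Proof. by move=> sc; rewrite gauss_primitive_ge0// divr_ge0. Qed.

Lemma barrier_le0 c k s : s + c <= 0 -> barrier c k s <= 0.
Proof. by move=> sc; rewrite gauss_primitive_le0// mulr_le0_ge0// invr_ge0. Qed.

End barrier.

Let bcst (a : R) := @locally_bounded_cst R a.

Section above.
Variables (B : nat -> set R) (g : nat -> R).
Hypothesis BE : forall i, B i = [set y | g i < y].
Hypothesis ge_small : forall i, (1 <= i <= n)%N -> `|g i| <= e.

Let mB i : measurable (B i).
Proof. by rewrite BE; exact: measurable_gt. Qed.

Lemma survival_above_ge sg j k s : 0 < sg -> e <= sg -> (k + j = n)%N ->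
  barrier sg n (- e) k s - barrier_error sg n k <= sm B (fun=> Goo) j k s.
Proof.
move=> sg0 esg.
have Goo0 : 0 <= Goo by rewrite divr_ge0.
apply: (survival_mean_ge mX Xe (F := fun k s => barrier sg n (- e) k s -
  barrier_error sg n k)) => //.
- by move=> i; apply: locally_boundedB => //; exact: locally_bounded_barrier.
- move=> s'; rewrite barrier_error_end subr0; exact: gauss_primitive_le.
- move=> i y iN; rewrite BE /= => /negP; rewrite -leNgt => yg.
  have i1n : (1 <= i.+1 <= n)%N by [].
  rewrite subr_le0 (le_trans (barrier_le0 _ _ _ _))// ?barrier_error_ge0//.
  by rewrite subr_le0 (le_trans yg)// (le_trans (ler_norm _))// ge_small.
- move=> i s' iN; rewrite (shifted_meanB P (mX _) (Xe _))//;
  last exact: locally_bounded_barrier.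
  rewrite shifted_mean_cst.
  have := barrier_step sg0 esg (leqnn n) (- e) s' iN; rewrite ler_norml; lra.
Qed.

Lemma survival_above_le sg c a j k s : 0 < sg -> e <= sg -> 2 * e <= c ->
  0 <= a -> a <= G ((c - e) / sg) ->
  (k + j = n)%N -> - e <= s ->
  sm B (fun=> a) j k s <= barrier sg n c k s + barrier_error sg n k.
Proof.
move=> sg0 esg ec a0 aG kj es; rewrite -[j]addn0.
have e0 := bound_ge0 Xe.
apply: (survival_mean_le mX Xe (F := fun k s => barrier sg n c k s +
  barrier_error sg n k)
  (D := fun k => [set s | - e <= s]) (N := n)) => //.
- by move=> i; apply: locally_boundedD => //; exact: locally_bounded_barrier.
- move=> s' /= es'; rewrite barrier_error_end addr0 barrier_end//.
  apply: le_trans aG _; apply: le_gauss_primitive.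
  by rewrite ler_pM2r ?invr_gt0//; lra.
- move=> i s' x iN _ _; rewrite BE /= => /ltW; apply: le_trans.
  have := @ge_small i.+1 iN; rewrite ler_norml; lra.
- move=> i s' x iN /= es' xe; rewrite addr_ge0 ?barrier_error_ge0//.
  by apply: barrier_ge0; move: xe; rewrite ler_norml; lra.
- move=> i s' iN _; rewrite (shifted_meanD P (mX _) (Xe _))//;
  last exact: locally_bounded_barrier.
  rewrite shifted_mean_cst.
  have := barrier_step sg0 esg (leqnn n) c s' iN; rewrite ler_norml; lra.
Qed.

Let excess (y : R) : R := Num.max 0 (y - g n).

Let bexcess : locally_bounded excess := @locally_bounded_excess R (g n).

Let excess0 : forall y, 0 <= excess y := excess_ge0 (g n).

Let shifted_mean_id i s b : (i < n)%N -> K i.+1 (fun y => y + b) s = s + b.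
Proof.
move=> iN.
have bid := locally_bounded_id R.
rewrite (shifted_meanD P (mX _) (Xe _))// shifted_mean_cst; congr (_ + _).
rewrite /shifted_mean.
have H := @locally_bounded_integrable _ _ _ P _ _ (mX i.+1) (Xe i.+1).
rewrite RintegralD//=.
- by rewrite EX// addr0 -/(shifted_mean P (X i.+1) (fun=> s) 0)
  shifted_mean_cst.
- exact: (H (fun=> s) 0 (@bcst s)).
- by have := H _ 0 bid; apply: eq_integrable => // w _ /=; rewrite add0r.
Qed.

Lemma mean_excess_le j k s : (1 <= n)%N -> (k + j = n)%N -> - e <= s ->
  sm B excess j k s <= s + 2 * e.
Proof.
move=> n1 kj es; rewrite -[j]addn0.
have e0 := bound_ge0 Xe.
apply: (survival_mean_le mX Xe (F := fun k s => s + 2 * e)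
  (D := fun k => [set s | - e <= s]) (N := n)) => //.
- by move=> i; apply: locally_boundedD => //; exact: locally_bounded_id.
- move=> s' /= es'; rewrite ge_max; apply/andP; split; first lra.
  have := @ge_small n; rewrite n1 leqnn => /(_ erefl); rewrite ler_norml; lra.
- move=> i s' x iN _ _; rewrite BE /= => /ltW; apply: le_trans.
  have := @ge_small i.+1 iN; rewrite ler_norml; lra.
- by move=> i s' x iN /= es'; rewrite ler_norml; lra.
- by move=> i s' iN _; rewrite shifted_mean_id.
Qed.

Lemma mean_excess_ge j k s : (1 <= n)%N -> (k + j = n)%N ->
  s - e <= sm B excess j k s.
Proof.
move=> n1.
apply: (survival_mean_ge mX Xe (F := fun k s => s - e) (N := n)) => //.
- by move=> i; apply: locally_boundedB => //; exact: locally_bounded_id.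
- move=> s'; rewrite le_max; apply/orP; right; rewrite lerD2l lerN2.
  by rewrite (le_trans (ler_norm _))// ge_small// n1 leqnn.
- move=> i y iN; rewrite BE /= => /negP; rewrite -leNgt => yg.
  by rewrite subr_le0 (le_trans yg)// (le_trans (ler_norm _))// ge_small.
- by move=> i s' iN; rewrite shifted_mean_id.
Qed.

End above.

Lemma survival_below_le (C : nat -> set R) (h : R) m sg c a j j0 k s :
  (m <= n)%N ->
  (forall i, C i = if (i <= m)%N then [set y | y < h] else setT) ->
  (forall i, measurable (C i)) ->
  0 < sg -> e <= sg -> e <= c -> 0 <= a -> a <= G (c / sg) ->
  (k + j = m)%N -> s <= h ->
  sm C (fun=> a) (j + j0) k s <= barrier_error sg m k - barrier sg m (- h - c)
    k s.
Proof.
move=> mn CE mC sg0 esg ec a0 aG kj sh.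
have e0 := bound_ge0 Xe.
apply: (survival_mean_le mX Xe
  (F := fun k s => barrier_error sg m k - barrier sg m (- h - c) k s)
  (D := fun k => [set s | s <= h]) (N := m)) => //.
- by move=> i; apply: locally_boundedB => //; exact: locally_bounded_barrier.
- move=> s' /= s'h; rewrite barrier_error_end sub0r barrier_end//
  -gauss_primitiveN.
  rewrite (survival_mean_cst P mX Xe)//.
  apply: (@le_trans _ _ (a * 1)); first by rewrite ler_wpM2l//
    (survival_mean_le1 P mX Xe).
  rewrite mulr1 (le_trans aG)//; apply: le_gauss_primitive.
  by rewrite -mulNr ler_pM2r ?invr_gt0//; lra.
- by move=> i s' x im _ _; rewrite CE im/= => /ltW.
- move=> i s' x im /= s'h xe; rewrite subr_ge0 (le_trans (barrier_le0 _ _ _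
  _))//.
    by move: xe; rewrite ler_norml; lra.
  exact: barrier_error_ge0.
- move=> i s' im _; rewrite (shifted_meanB P (mX _) (Xe _))//;
  last exact: locally_bounded_barrier.
  rewrite shifted_mean_cst.
  have := barrier_step sg0 esg mn (- h - c) s' im; rewrite ler_norml; lra.
Qed.

End survival_bounds.

Section universality.
Variable R : realType.

Local Notation G := (@gauss_primitive R).
Local Notation Goo := (Num.sqrt pi / 2 : R).

Lemma sqrt_pi_half_ge : 1 / 2 <= Goo.
Proof.
rewrite ler_pM2r ?invr_gt0// -sqrtr1 ler_wsqrtr// (le_trans _ (pi_ge2 R))//.
by rewrite ler1n.
Qed.

Lemma sqrt_2_div_piM : Num.sqrt (2 / pi) * (Num.sqrt 2 * Goo) = 1.
Proof.
rewrite sqrtrM// sqrtrV ?pi_ge0//.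
have p0 : Num.sqrt (pi : R) != 0 by rewrite gt_eqF// sqrtr_gt0 pi_gt0.
rewrite [LHS](_ : _ = Num.sqrt 2 ^+ 2 / 2); last by field.
by rewrite sqr_sqrtr// divff.
Qed.

Lemma gauss_primitive_height_ge (x h s e V : R) :
  0 < x -> x <= 1 / 10 -> 0 < h -> h <= x / 160 -> e <= x * h / 2 -> h <= s ->
  1 <= V -> V <= 2 + x ^+ 2 ->
  h * (1 - x) ^+ 3 <= Num.sqrt 2 * G ((s - e) / Num.sqrt V).
Proof.
move=> x0 x1 h0 hx ex hs V1 Vx.
set s2 := Num.sqrt 2; set q := Num.sqrt V.
have s20 : 0 < s2 by rewrite sqrtr_gt0.
have s22 : s2 ^+ 2 = 2 by rewrite sqr_sqrtr.
have s21 : 1 <= s2 by rewrite -sqrtr1 ler_wsqrtr// ler1n.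
have q0 : 0 < q by rewrite sqrtr_gt0; lra.
have q2 : q ^+ 2 = V by rewrite sqr_sqrtr; lra.
have x01 : 0 <= 1 - x by lra.
have qs2 : q * (1 - x) <= s2.
  rewrite -(ler_pXn2r (n:=2)) ?nnegrE ?(ltW s20) ?mulr_ge0 ?(ltW q0)//.
  rewrite exprMn q2 s22.
  have : (1 - x) ^+ 2 <= 1 - x by clear -x0 x1; nra.
  have : (2 + x ^+ 2) * (1 - x) <= 2 by clear -x0 x1; nra.
  by clear -x01 V1 Vx; move: ((1 - x) ^+ 2) (x ^+ 2) Vx => r r'; nra.
pose z0 := h * (1 - x) ^+ 2 / s2.
have z00 : 0 <= z0 by rewrite divr_ge0 ?mulr_ge0 ?sqr_ge0 ?(ltW s20)// ltW.
have z0h : z0 <= h.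
  rewrite ler_pdivrMr// ler_wpM2l ?(ltW h0)// (le_trans _ s21)//.
  by clear -x0 x1; nra.
have z0le : z0 <= (s - e) / q.
  rewrite ler_pdivlMr// /z0 mulrAC ler_pdivrMr//.
  apply: (@le_trans _ _ (h * (1 - x) * s2)).
    rewrite expr2 -!mulrA ler_wpM2l ?(ltW h0)// ler_wpM2l//.
    by rewrite mulrC.
  by rewrite ler_wpM2r ?(ltW s20)//; clear -x0 h0 ex hs; nra.
have z0x : z0 ^+ 2 <= x by clear -x0 x1 h0 hx z00 z0h; nra.
have := le_gauss_primitive z0le; have := gauss_primitive_ge z00.
have : z0 * (1 - x) <= z0 * (1 - z0 ^+ 2) by rewrite ler_wpM2l// lerD2l lerN2.
have -> : h * (1 - x) ^+ 3 = s2 * (z0 * (1 - x)).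
  by rewrite /z0; field; rewrite gt_eqF.
move=> H1 H2 H3; apply: ler_wpM2l; first exact: ltW.
exact: (le_trans H1 (le_trans H2 H3)).
Qed.

Lemma gauss_primitive_height_le (x V y : R) :
  0 < x -> x <= 1 / 10 ->
  2 * (1 - x) <= V -> 0 <= y ->
  Num.sqrt 2 * (1 - x) * G (y / Num.sqrt V) <= y.
Proof.
move=> x0 x1 Vx y0.
set s2 := Num.sqrt 2; set q := Num.sqrt V.
have s20 : 0 < s2 by rewrite sqrtr_gt0.
have s22 : s2 ^+ 2 = 2 by rewrite sqr_sqrtr.
have q0 : 0 < q by rewrite sqrtr_gt0; lra.
have q2 : q ^+ 2 = V by rewrite sqr_sqrtr; lra.
have x01 : 0 <= 1 - x by lra.
have qs2 : s2 * (1 - x) <= q.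
  rewrite -(ler_pXn2r (n:=2)) ?nnegrE ?(ltW q0) ?mulr_ge0 ?(ltW s20)//.
  by rewrite exprMn q2 s22; clear -x0 x1 Vx; nra.
have z0 : 0 <= y / q by rewrite divr_ge0// ltW.
have := gauss_primitive_le_id z0; rewrite ler_pdivlMr// mulrC => H.
apply: le_trans H; rewrite ler_wpM2r//; exact: gauss_primitive_ge0.
Qed.

Lemma height_ratio_ge (x h s e b err w a s2 : R) :
  0 < x -> x <= 1 / 10 -> 0 < h -> e <= x * h / 2 -> s <= h + e ->
  1 <= s2 -> s2 <= 2 ->
  b - err <= w -> a <= s + 2 * e -> err <= x * h / 2 ->
  h * (1 - x) ^+ 3 <= s2 * b -> a * (1 - 7 * x) <= s2 * w.
Proof.
move=> x0 x1 h0 ex she s21 s22 H1 H2 H3 H4.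
have H5 : a * (1 - 7 * x) <= h * (1 + 3 / 2 * x) * (1 - 7 * x).
  by rewrite ler_wpM2r//; lra.
have H6 : h * ((1 + 3 / 2 * x) * (1 - 7 * x)) <= h * ((1 - x) ^+ 3 - x).
  rewrite ler_wpM2l ?(ltW h0)//; clear -x0 x1; rewrite -subr_ge0.
  rewrite (_ : _ - _ = x * (3 / 2 + 27 / 2 * x - x ^+ 2)); last by field.
  by rewrite mulr_ge0 ?(ltW x0)//; nra.
have H7 : s2 * (b - err) <= s2 * w by rewrite ler_wpM2l//; lra.
have H8 : s2 * err <= x * h.
  apply: (@le_trans _ _ (s2 * (x * h / 2))); first by rewrite ler_wpM2l//; lra.
  have : 0 <= x * h by rewrite mulr_ge0 ?ltW.
  by move: (x * h) => r; clear -s22; nra.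
by lra.
Qed.

Lemma height_ratio_le (x h s e b err w a s2 : R) :
  0 < x -> x <= 1 / 10 -> 0 < h -> e <= x * h / 2 -> h <= s -> s <= h + e ->
  1 <= s2 -> s2 <= 2 -> 0 <= w ->
  (1 - x) * w <= b + err -> s - e <= a -> err <= x * h / 2 ->
  s2 * (1 - x) * b <= s + x * h -> s2 * w <= a * (1 + 10 * x).
Proof.
move=> x0 x1 h0 ex hs she s21 s22 w0 H1 H2 H3 H4.
have xh0 : 0 <= x * h by rewrite mulr_ge0 ?ltW.
have c0 : 0 <= s2 * (1 - x) by rewrite mulr_ge0//; lra.
have c2 : s2 * (1 - x) <= 2 by clear -s21 s22 x0 x1; nra.
have H5 : s2 * (1 - x) * ((1 - x) * w) <= s2 * (1 - x) * (b + err).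
  by rewrite ler_wpM2l.
have H6 : s2 * (1 - x) * err <= x * h.
  apply: (@le_trans _ _ (s2 * (1 - x) * (x * h / 2)));
    first by rewrite ler_wpM2l.
  by move: (x * h) (s2 * (1 - x)) xh0 c2 => r c; clear; nra.
have H7 : h * (1 + 5 / 2 * x) <= h * ((1 - x / 2) * (1 + 10 * x) * (1 - x) ^+
  2).
  rewrite ler_wpM2l ?(ltW h0)//; clear -x0 x1.
  have : 1 - 2 * x <= (1 - x) ^+ 2 by nra.
  have : 1 + 9 * x <= (1 - x / 2) * (1 + 10 * x) by nra.
  move: ((1 - x / 2) * (1 + 10 * x)) ((1 - x) ^+ 2) => r r'; nra.
have H8 : h * (1 - x / 2) * ((1 + 10 * x) * (1 - x) ^+ 2) <=
    a * ((1 + 10 * x) * (1 - x) ^+ 2).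
  rewrite ler_wpM2r ?mulr_ge0 ?sqr_ge0//; lra.
have x2 : 0 < (1 - x) ^+ 2 by rewrite exprn_gt0//; lra.
rewrite -(ler_pM2r x2); lra.
Qed.

Lemma below_height_le (x h b c err y : R) :
  0 < x -> x <= 1 / 10 -> h <= x / 160 -> 0 <= b -> 1 / 2 <= c ->
  (1 - x) * c * b <= err + y -> err <= x * h / 2 -> y <= x * (1 + x) / 16 ->
  b <= x.
Proof.
move=> x0 x1 hx b0 c2 H1 H2 H3.
have H4 : 9 / 20 * b <= (1 - x) * c * b.
  by rewrite ler_wpM2r//; clear -x0 x1 c2; nra.
have H5 : x * h / 2 + x * (1 + x) / 16 <= 9 / 20 * x by clear -x0 x1 hx; nra.
by lra.
Qed.

Lemma survival_ratio (x p p' E E' b k0 : R) :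
  0 < x -> x <= 1 / 10 ->
  0 < k0 -> 0 <= p -> 0 <= E ->
  0 <= p' -> 0 <= E' -> b <= x -> p' <= p * b -> E' <= E * b ->
  p - p' <= k0 * (1 + 10 * x) * (E - E') ->
  E - E' <= (k0 * (1 - 7 * x))^-1 * (p - p') ->
  (1 - 13 * x) * (k0 * E) <= p /\ p <= (1 + 13 * x) * (k0 * E).
Proof.
move=> x0 x1 k00 p0 E0 p0' E0' bx pb Eb H1 H2.
have pb' : p * b <= p * x by rewrite ler_wpM2l.
have Eb' : E * b <= E * x by rewrite ler_wpM2l.
have kE0 : 0 <= k0 * E by rewrite mulr_ge0// ltW.
have kE0' : 0 <= k0 * E' by rewrite mulr_ge0// ltW.
have H3 : (1 - 7 * x) * (k0 * (E - E')) <= p - p'.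
  have c0 : 0 < k0 * (1 - 7 * x) by rewrite mulr_gt0//; lra.
  by move: H2; rewrite ler_pdivlMl//; lra.
have H4 : k0 * (E * x) >= k0 * E' by rewrite ler_wpM2l ?(ltW k00)//; lra.
move: H1 H3 H4; rewrite mulrAC [k0 * (E - E')]mulrBr mulrA.
move: (k0 * E) (k0 * E') kE0 kE0' => A A' A0 A0' H1 H3 H4.
split; clear -x0 x1 p0 p0' A0 A0' H1 H3 H4 pb pb'; first by nra.
have : p * (1 - x) <= A * (1 + 10 * x) by nra.
have : A * (1 + 10 * x) <= A * ((1 + 13 * x) * (1 - x)).
  by rewrite ler_wpM2l//; nra.
move=> h1 h2; have x10 : 0 < 1 - x by lra.
by rewrite -(ler_pM2r x10); lra.
Qed.

Section fixed_row.
Context d (T : measurableType d) (P : probability T R).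
Variables (X : nat -> T -> R) (e : R) (n : nat) (v g : nat -> R).
Hypotheses (mX : forall i, measurable_fun setT (X i))
  (Xe : forall i w, `|X i w| <= e).
Hypotheses (EX : forall i, (1 <= i <= n)%N -> \int[P]_w X i w = 0)
  (EX2 : forall i, (1 <= i <= n)%N -> \int[P]_w (X i w ^+ 2) = v i).
Hypotheses (v1 : clock v n = 1).
Hypotheses (ge_small : forall i, (1 <= i <= n)%N -> `|g i| <= e).

Lemma exists_clock x : 0 < x -> x <= 1 -> e ^+ 2 <= x / 2 ->
  exists2 m, (m <= n)%N & x / 2 <= clock v m <= x.
Proof.
move=> x0 x1 ex.
have ex1 : exists k, (k <= n)%N && (x / 2 <= clock v k).
  by exists n; rewrite leqnn v1; lra.
case: (ex_minnP ex1) => -[|m] /andP[mn xm] mmin.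
  by move: xm; rewrite clock0; lra.
exists m.+1; rewrite // xm clockS.
have /andP[_ vm] := step_variance_bounds mX Xe EX2 (mn : (1 <= m.+1 <= n)%N).
have : clock v m < x / 2.
  rewrite ltNge; apply/negP => xm'.
  by have := mmin m; rewrite xm' (ltnW mn) ltnn => /(_ erefl).
by rewrite /=; lra.
Qed.

Local Notation sm := (survival_mean P X).
Local Notation B := (fun i => [set y : R | g i < y]).
Local Notation excess := (fun y : R => Num.max 0 (y - g n)).

(* Constants: the drop [x h] of the barrier, its smoothing [sg], and the height
   [h = x ^+ 2 / 16], small with respect to the deviation [x ^+ (1 / 2)] of the
   walk at the time [m] of clock about [x]. *)
Lemma survival_mean_asymp x sg :
  0 < x -> x <= 1 / 10 ->
  let h := x ^+ 2 / 16 in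
  0 < sg -> sg <= x -> (1 - x) * Goo <= G (x * h / 2 / sg) ->
  e <= x * h / 2 -> e <= sg -> 20 * e / sg ^+ 3 <= x * h / 2 ->
  let p := sm B (fun=> 1) n 0 0 in
  let q := Num.sqrt (2 / pi) * sm B excess n 0 0 in
  (1 - 13 * x) * q <= p /\ p <= (1 + 13 * x) * q.
Proof.
move=> x0 x1 h sg0 sgx xG exh esg Ce p q.
have e0 : 0 <= e := bound_ge0 Xe.
have n1 : (1 <= n)%N.
  by rewrite lt0n; apply/eqP => n0; move: v1; rewrite n0 clock0 => /eqP;
    rewrite eq_sym oner_eq0.
have h0 : 0 < h by rewrite divr_gt0// exprn_gt0.
have hx : h <= x / 160 by rewrite /h; nra.
have Goo2 := sqrt_pi_half_ge.
set s2 := Num.sqrt (2 : R).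
have s20 : 0 < s2 by rewrite sqrtr_gt0.
have s22 : s2 ^+ 2 = 2 by rewrite sqr_sqrtr.
set k0 := Num.sqrt (2 / pi) in q *.
have k00 : 0 < k0 by rewrite sqrtr_gt0 divr_gt0// pi_gt0.
have k0G : k0 * (s2 * Goo) = 1 by exact: sqrt_2_div_piM.
have ex2 : e ^+ 2 <= x / 2 by nra.
have [|m mn /andP[xm mx]] := exists_clock x0 _ ex2; first lra.
pose C i := if (i <= m)%N then [set y | y < h] else setT.
have mC i : measurable (C i).
  by rewrite /C; case: ifP => _ //; exact: measurable_lt.
have mB i : measurable (B i) by exact: measurable_gt.
have mnE : (m + (n - m) = n)%N by rewrite subnKC.
have bexcess : locally_bounded excess by exact: locally_bounded_excess.
have excess0 : forall y, 0 <= excess y by exact: excess_ge0.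
have bone : locally_bounded (fun=> 1 : R) by exact: locally_bounded_cst.
have err_le N k : (N <= n)%N -> (k <= N)%N -> barrier_error e v sg N k <= x * h
  / 2.
  move=> Nn kN; rewrite /barrier_error (le_trans _ Ce)// ler_piMr//.
    by rewrite divr_ge0 ?mulr_ge0 ?exprn_ge0// ltW.
  have := le_clock mX Xe EX2 Nn (leqnn n); have := le_clock mX Xe EX2 (leq0n k)
    (leq_trans kN Nn).
  by rewrite clock0 v1; lra.
have s21 : 1 <= s2 by rewrite -sqrtr1 ler_wsqrtr// ler1n.
have s2_le2 : s2 <= 2 by nra.
have clock_k k : (k <= m)%N -> 0 <= clock v k <= x.
  move=> km; have := le_clock mX Xe EX2 km mn.
  have := le_clock mX Xe EX2 (leq0n k) (leq_trans km mn); rewrite clock0; lra.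
have x01 : 0 <= 1 - x <= 1 by lra.
have aG : 0 <= (1 - x) * Goo by rewrite mulr_ge0//; lra.
have low j k s : (k + j = m)%N -> h <= s <= h + e ->
    sm B excess (j + (n - m)) k s <=
    (k0 * (1 - 7 * x))^-1 * sm B (fun=> 1) (j + (n - m)) k s.
  move=> kj /andP[hs she].
  have km : (k <= m)%N by rewrite -kj leq_addr.
  have kJ : (k + (j + (n - m)) = n)%N by rewrite addnA kj.
  have es : - e <= s by lra.
  have := mean_excess_le mX Xe EX (fun=> erefl) ge_small n1 kJ es.
  have := survival_above_ge mX Xe EX EX2 (fun=> erefl) ge_small s sg0 esg kJ.
  rewrite (survival_mean_cst P mX Xe)//.
  move: (sm B (fun=> 1) _ k s) (sm B excess _ k s) => p1 a1 H1 H2.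
  rewrite mulrC ler_pdivlMr; last by rewrite mulr_gt0//; lra.
  have H3 := err_le n k (leqnn n) (leq_trans km mn).
  have H4 : h * (1 - x) ^+ 3 <= s2 * barrier v sg n (- e) k s.
    rewrite /barrier v1; apply: gauss_primitive_height_ge => //.
      by have := clock_k k km; have := sqr_ge0 sg; lra.
    apply: lerD; last by rewrite lerXn2r ?nnegrE ?(ltW sg0) ?(ltW x0).
    by rewrite ler_piMr// gerBl; have /andP[] := clock_k k km.
  have H5 : a1 * (1 - 7 * x) <= s2 * Goo * p1.
    rewrite -mulrA; exact: (height_ratio_ge x0 x1 h0 exh she s21 s2_le2 H1 H2
      H3 H4).
  rewrite -(ler_pM2l (_ : 0 < s2 * Goo)); last by rewrite mulr_gt0//; lra.
  apply: le_trans H5; rewrite le_eqVlt; apply/orP; left; apply/eqP.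
  by transitivity (k0 * (s2 * Goo) * (a1 * (1 - 7 * x)));
    [ring|rewrite k0G mul1r].
have upp j k s : (k + j = m)%N -> h <= s <= h + e ->
    sm B (fun=> 1) (j + (n - m)) k s <=
    k0 * (1 + 10 * x) * sm B excess (j + (n - m)) k s.
  move=> kj /andP[hs she].
  have km : (k <= m)%N by rewrite -kj leq_addr.
  have kJ : (k + (j + (n - m)) = n)%N by rewrite addnA kj.
  have es : - e <= s by lra.
  have ec : 2 * e <= x * h by lra.
  have aG' : (1 - x) * Goo <= G ((x * h - e) / sg).
    by rewrite (le_trans xG)// le_gauss_primitive// ler_pM2r ?invr_gt0//; lra.
  have := mean_excess_ge mX Xe EX (fun=> erefl) ge_small s n1 kJ.
  have := survival_above_le mX Xe EX EX2 (fun=> erefl) ge_small sg0 esg ec aG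
    aG' kJ es.
  rewrite (survival_mean_cst P mX Xe)//.
  have := survival_mean_ge0 P X B (j + (n - m)) k s (fun=> ler01).
  move: (sm B (fun=> 1) _ k s) (sm B excess _ k s) => p1 a1 p10 H1 H2.
  have H3 := err_le n k (leqnn n) (leq_trans km mn).
  have H4 : s2 * (1 - x) * barrier v sg n (x * h) k s <= s + x * h.
    rewrite /barrier v1; apply: gauss_primitive_height_le => //.
      by have := clock_k k km; have := sqr_ge0 sg; lra.
    by rewrite addr_ge0 ?mulr_ge0 ?ltW// (lt_le_trans h0).
  have H5 : s2 * Goo * p1 <= a1 * (1 + 10 * x).
    rewrite -mulrA; apply: (height_ratio_le x0 x1 h0 exh hs she s21 s2_le2 _ _
      H2 H3 H4).
      by rewrite mulr_ge0//; lra.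
    by rewrite mulrA.
  rewrite -(ler_pM2l (_ : 0 < s2 * Goo)); last by rewrite mulr_gt0//; lra.
  apply: (le_trans H5); rewrite le_eqVlt; apply/orP; left; apply/eqP.
  by transitivity (k0 * (s2 * Goo) * (a1 * (1 + 10 * x)));
    [rewrite k0G mul1r|ring].
have below : sm C (fun=> 1) n 0 0 <= x.
  have ec : e <= x * h by nra.
  have aG' : (1 - x) * Goo <= G (x * h / sg).
    by rewrite (le_trans xG)// le_gauss_primitive// ler_pM2r ?invr_gt0//; lra.
  have := survival_below_le mX Xe EX EX2 (n - m) mn (fun=> erefl) mC sg0 esg ec
    aG aG'
    (add0n m) (ltW h0).
  rewrite mnE (survival_mean_cst P mX Xe)//.
  have := survival_mean_ge0 P X C n 0 0 (fun=> ler01).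
  move: (sm C (fun=> 1) _ _ _) => b b0.
  have H3 := err_le m 0 mn (leq0n m).
  rewrite /barrier clock0 subr0 add0r -opprD mulNr gauss_primitiveN opprK.
  set V := 2 * _ + _; set q' := Num.sqrt V => H1.
  have Vx : x ^+ 2 <= V by rewrite /V; nra.
  have q'0 : 0 < q' by rewrite sqrtr_gt0; nra.
  have q'x : x <= q'.
    rewrite -(ler_pXn2r (n:=2)) ?nnegrE ?(ltW q'0) ?(ltW x0)// sqr_sqrtr//.
    by rewrite (le_trans _ Vx)// sqr_ge0.
  have hx0 : 0 <= h + x * h by rewrite addr_ge0 ?mulr_ge0 ?ltW.
  have H2 : G ((h + x * h) / q') <= x * (1 + x) / 16.
    rewrite (le_trans (gauss_primitive_le_id _)) ?divr_ge0 ?(ltW q'0)//.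
    rewrite ler_pdivrMr// (@le_trans _ _ (x * (1 + x) / 16 * x))//.
      by rewrite /h; lra.
    by rewrite ler_wpM2l// divr_ge0 ?mulr_ge0 ?addr_ge0 ?(ltW x0).
  exact: (below_height_le x0 x1 hx b0 Goo2 H1 H3 H2).
have CE i : C i = if (i <= m)%N then [set y | y < h] else setT by [].
pose BC i := B i `&` C i.
have uB i y z : y <= z -> B i y -> B i z by move=> yz /= /lt_le_trans; apply.
have dC i y z : y <= z -> C i z -> C i y.
  by move=> yz; rewrite /C; case: ifP => // _ /=; exact: le_lt_trans.
have HP : sm BC (fun=> 1) n 0 0 <= sm B (fun=> 1) n 0 0 * sm C (fun=> 1) n 0 0.
  exact: (survival_mean_harris P mX Xe).
have HE : sm BC excess n 0 0 <= sm B excess n 0 0 * sm C (fun=> 1) n 0 0.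
  apply: (survival_mean_harris P mX Xe) => //.
  by move=> y z yz; rewrite ge_max le_max lexx/= le_max lerD2r yz orbT.
have DP := survival_mean_passage_le mX Xe mB CE (fun=> ler01) bone excess0
  bexcess upp (add0n m) h0.
have DE := survival_mean_passage_le mX Xe mB CE excess0 bexcess (fun=> ler01)
  bone low (add0n m) h0.
rewrite mnE -/BC in DP DE.
have p0 := survival_mean_ge0 P X B n 0 0 (fun=> ler01).
have E0 := survival_mean_ge0 P X B n 0 0 excess0.
have p0' := survival_mean_ge0 P X BC n 0 0 (fun=> ler01).
have E0' := survival_mean_ge0 P X BC n 0 0 excess0.
exact: (survival_ratio x0 x1 k00 p0 E0 p0' E0' below HP HE DP DE).
Qed.

End fixed_row.

End universality.
Section clipped_row.
Context d (T : measurableType d) (R : realType) (P : probability T R).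
Variables (X : nat -> {RV P >-> R}) (n : nat) (g : nat -> R) (e : R).
Hypotheses (n1 : (1 <= n)%N) (X_indep : independent_row n X)
  (X_centered : forall i, (1 <= i <= n)%N -> ('E_P[X i] = 0)%E)
  (X_variance : (\sum_(1 <= i < n.+1) 'E_P[fun w => (X i w ^+ 2)%R] = 1)%E).
Hypotheses (e0 : 0 <= e) (Xe : {ae P, forall w i, (1 <= i <= n)%N -> `|X i w|
  <= e}).

Local Notation B := (fun i => [set y : R | g i < y]).

Definition clip (y : R) : R := Num.max (- e) (Num.min e y).
Definition clipped i w : R := clip (X i w).

Local Notation Y := clipped.

Lemma clip_id y : `|y| <= e -> clip y = y.
Proof.
rewrite ler_norml => /andP[ey ye]; rewrite /clip.
by rewrite (min_idPr ye) (max_idPr ey).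
Qed.

Lemma norm_clip_le y : `|clip y| <= e.
Proof.
rewrite ler_norml /clip le_max lexx ge_max ge_min lexx andbT/=.
by rewrite ge0_cp.
Qed.

Lemma measurable_clip : measurable_fun setT clip.
Proof.
apply: measurable_maxr; first exact: measurable_cst.
by apply: measurable_minr; [exact: measurable_cst|exact: measurable_id].
Qed.

Lemma measurable_clipped i : measurable_fun setT (Y i).
Proof. by apply: measurableT_comp; [exact: measurable_clip|]. Qed.

Lemma norm_clipped_le i w : `|Y i w| <= e.
Proof. exact: norm_clip_le. Qed.

Lemma ae_clippedE : {ae P, forall w i, (1 <= i <= n)%N -> Y i w = X i w}.
Proof. by apply: filterS Xe => w h i i1n; rewrite /clipped clip_id// h. Qed.

Lemma survivalE : survival n X g = stays X B n.
Proof.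
apply/seteqP; split => w /=.
  rewrite /survival/= /passage_time => h i i1n /=; rewrite ltNge;
    apply/negP => Sg.
  have : (n%:R%:E < i%:R%:E :> \bar R)%E.
    by apply: (lt_le_trans h); apply: ereal_inf_lbound; exists i.
  by rewrite lte_fin ltr_nat ltnNge; case/andP: i1n => _ ->.
move=> h; rewrite /survival/= /passage_time.
rewrite (_ : [set k : nat | _] = set0) ?image_set0 ?ereal_inf0 ?ltry//.
apply/seteqP; split => k //= -[k1n]; apply/negP; rewrite -ltNge.
exact: h.
Qed.

Lemma row_sum_clipped w : (forall i, (1 <= i <= n)%N -> Y i w = X i w) ->
  forall k, (k <= n)%N -> row_sum Y k w = row_sum X k w.
Proof.
move=> YX k kn; rewrite /row_sum; apply: eq_big_nat => i /andP[i1 ik].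
by rewrite YX// i1 (leq_trans _ kn).
Qed.

Lemma stays_clipped w : (forall i, (1 <= i <= n)%N -> Y i w = X i w) ->
  \1_(stays Y B n) w = \1_(stays X B n) w :> R.
Proof.
move=> YX; rewrite !indicE; congr (_%:R); congr nat_of_bool.
apply/idP/idP; rewrite !inE => h i /[dup] i1n /andP[_ iN].
  by rewrite -(row_sum_clipped YX)//; exact: h.
by rewrite (row_sum_clipped YX)//; exact: h.
Qed.

Lemma measurable_row_sum (Z : nat -> T -> R) k :
  (forall i, measurable_fun setT (Z i)) -> measurable_fun setT (row_sum Z k).
Proof. by move=> mZ; apply: measurable_sum. Qed.

Lemma measurable_stays (Z : nat -> T -> R) k :
  (forall i, measurable_fun setT (Z i)) -> measurable (stays Z B k).
Proof.
move=> mZ.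
rewrite (_ : stays Z B k =
  \bigcap_(i in [set i | (1 <= i <= k)%N]) (row_sum Z i @^-1` B i))//.
apply: bigcap_measurableType => i _; rewrite -[X in measurable X]setTI.
apply: measurable_row_sum => //.
exact: measurable_gt.
Qed.

Lemma clipped_indep (J : seq nat) (D : nat -> set R) :
  uniq J -> {subset J <= index_iota 1 n.+1} -> (forall i, measurable (D i)) ->
  P (\bigcap_(i in [set` J]) (Y i @^-1` D i)) = (\prod_(i <- J) P (Y i @^-1` D
    i))%E.
Proof.
move=> uJ Jn mD; apply: (X_indep (B := fun i => clip @^-1` D i)) => // i.
by rewrite -[X in measurable X]setTI; exact: measurable_clip.
Qed.

Lemma ae_eq_clipped (phi : R -> R) i : (1 <= i <= n)%N -> measurable_fun setT
  phi ->
  (\int[P]_w (phi (Y i w))%:E = \int[P]_w (phi (X i w))%:E)%E.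
Proof.
move=> i1n mphi; apply: ae_eq_integral => //.
- by apply/measurable_EFinP; apply: measurableT_comp => //;
  exact: measurable_clipped.
- by apply/measurable_EFinP; exact: measurableT_comp.
- by apply: filterS ae_clippedE => w YX _; rewrite YX.
Qed.

Lemma clipped_centered i : (1 <= i <= n)%N -> \int[P]_w Y i w = 0.
Proof.
move=> i1n; rewrite /Rintegral (ae_eq_clipped i1n (@measurable_id _ _ setT)).
by have := X_centered i1n; rewrite unlock => ->.
Qed.

Lemma clipped_variance : clock (fun i => \int[P]_w (Y i w ^+ 2)) n = 1.
Proof.
apply: EFin_inj; rewrite -X_variance /clock -sumEFin;
  apply: eq_big_nat => i i1n.
rewrite unlock -(ae_eq_clipped i1n (measurable_funX 2 (@measurable_id _ _
  setT))).
have := EFin_shifted_mean P (measurable_clipped i) (norm_clipped_le i) 0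
  (locally_bounded_continuous (@exprn_continuous R 2)).
under [X in _ = X -> _]eq_integral do rewrite add0r.
by move=> <-; congr EFin; apply: eq_Rintegral => w _; rewrite add0r.
Qed.

Lemma survival_clippedE :
  fine (P (survival n X g)) = survival_mean P Y B (fun=> 1) n 0 0.
Proof.
have mB i : measurable (B i) by exact: measurable_gt.
apply: EFin_inj; rewrite -(integral_survival_mean measurable_clipped
  norm_clipped_le
  clipped_indep mB (fun=> ler01) (locally_bounded_cst 1)).
rewrite fineK ?fin_num_measure//; last by rewrite survivalE;
  exact: measurable_stays.
rewrite survivalE; set A := stays X B n.
have mA : measurable A by exact: measurable_stays.
have -> : (P A = \int[P]_w (\1_A w)%:E)%E by rewrite integral_indic// setIT.
apply: ae_eq_integral => //.
- exact/measurable_EFinP/measurable_indic.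
- apply/measurable_EFinP; apply: measurable_funM => //.
  by apply: measurable_indic; apply: measurable_stays;
    exact: measurable_clipped.
- by apply: filterS ae_clippedE => w YX _; rewrite mulr1 stays_clipped.
Qed.

Lemma expectation_clippedE :
  fine (expectation_on P (fun w => row_sum X n w - g n) (survival n X g)) =
  survival_mean P Y B (fun y => Num.max 0 (y - g n)) n 0 0.
Proof.
have mB i : measurable (B i) by exact: measurable_gt.
have bexcess := @locally_bounded_excess R (g n).
have := integral_survival_mean measurable_clipped norm_clipped_le
  clipped_indep mB (excess_ge0 (g n)) bexcess.
rewrite survivalE /expectation_on unlock => H.
rewrite -[RHS]/(fine (survival_mean _ _ _ _ _ _ _)%:E) -H; congr fine.
apply: ae_eq_integral => //.
- apply/measurable_EFinP; apply: measurable_funM.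
    by apply: measurable_funB => //; exact: measurable_row_sum.
  by apply: measurable_indic; exact: measurable_stays.
- apply/measurable_EFinP; apply: measurable_funM.
    by apply: measurable_indic; apply: measurable_stays;
      exact: measurable_clipped.
  apply: (measurableT_comp bexcess.1).
  by apply: measurable_row_sum => i; exact: measurable_clipped.
apply: filterS ae_clippedE => w YX _; congr EFin.
rewrite mulrC (row_sum_clipped YX)// (stays_clipped YX).
rewrite indicE; have [/set_mem Sw|_] := boolP (_ \in _); last by rewrite !mul0r.
rewrite !mul1r (max_idPr _)// subr_ge0 ltW//.
by apply: Sw; rewrite n1 leqnn.
Qed.

Lemma survival_asymp x sg :
  (forall i, (1 <= i <= n)%N -> `|g i| <= e) ->
  0 < x -> x <= 1 / 10 -> let h := x ^+ 2 / 16 in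
  0 < sg -> sg <= x -> (1 - x) * (Num.sqrt pi / 2) <= gauss_primitive (x * h /
    2 / sg) ->
  e <= x * h / 2 -> e <= sg -> 20 * e / sg ^+ 3 <= x * h / 2 ->
  let p := fine (P (survival n X g)) in
  let q := Num.sqrt (2 / pi) *
    fine (expectation_on P (fun w => row_sum X n w - g n) (survival n X g)) in
  (1 - 13 * x) * q <= p /\ p <= (1 + 13 * x) * q.
Proof.
move=> ge x0 x1 h sg0 sgx xG exh esg Ce.
rewrite survival_clippedE expectation_clippedE.
exact: (survival_mean_asymp measurable_clipped norm_clipped_le clipped_centered
  (fun _ _ => erefl) clipped_variance ge x0 x1 sg0 sgx xG exh esg Ce).
Qed.

End clipped_row.

Lemma near_ratio1 (R : realType) (p q x eps : R) : 0 < p -> 0 < x -> x <= 1 /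
  10 ->
  13 * x < eps ->
  (1 - 13 * x) * q <= p -> p <= (1 + 13 * x) * q -> `|1 - p / q| < eps.
Proof.
move=> p0 x0 x1 xe H1 H2.
have q0 : 0 < q.
  rewrite -(pmulr_rgt0 _ (_ : 0 < 1 + 13 * x)); first exact: lt_le_trans H2.
  by lra.
have h1 : p / q <= 1 + 13 * x by rewrite ler_pdivrMr.
have h2 : 1 - 13 * x <= p / q by rewrite ler_pdivlMr.
by apply: le_lt_trans xe; rewrite ler_norml; lra.
Qed.

Unset Implicit Arguments.
Set Strict Implicit.

Theorem corollary2 (R : realType)
    (d : nat -> measure_display)
    (Omega : forall n : nat, measurableType (d n))
    (P : forall n : nat, probability (Omega n) R)
    (X : forall n : nat, nat -> {RV (P n) >-> R})
    (g : nat -> nat -> R)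
    (X_indep : forall n : nat, (1 <= n)%N -> independent_row n (X n))
    (X_centered : forall n i : nat, (1 <= i <= n)%N ->
       ('E_(P n)[X n i] = 0)%E)
    (X_variance : forall n : nat, (1 <= n)%N ->
       (\sum_(1 <= i < n.+1) 'E_(P n)[fun w => (X n i w ^+ 2)%R] = 1)%E)
    (g_small :
       (fun n : nat => \big[Num.max/0]_(1 <= k < n.+1) `|g n k|) @ \oo
         --> (0 : R))
    (survival_gt0 : forall n : nat, (1 <= n)%N ->
       (0 < P n (survival n (X n) (g n)))%E)
    (X_small : exists r : nat -> R,
       (forall n : nat, (1 <= n)%N ->
          {ae P n, forall w,
             \big[Num.max/0]_(1 <= i < n.+1) `|X n i w| <= r n}) /\
       r @ \oo --> (0 : R)) :
  asymp_equiv
    (fun n : nat => fine (P n (survival n (X n) (g n))))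
    (fun n : nat =>
       Num.sqrt (2 / pi) *
       fine (expectation_on (P n)
               (fun w => row_sum (X n) n w - g n n)
               (survival n (X n) (g n)))).
Proof.
have [r [Xr r0]] := X_small.
apply/cvgrPdist_lt => eps eps0.
pose x : R := Num.min (1 / 10) (eps / 26).
have x0 : 0 < x by rewrite lt_min; apply/andP; split; lra.
have x1 : x <= 1 / 10 by rewrite ge_min lexx.
have xeps : 13 * x < eps.
  have : x <= eps / 26 by rewrite ge_min lexx orbT.
  lra.
pose h := x ^+ 2 / 16.
have h0 : 0 < h by rewrite divr_gt0// exprn_gt0.
have [|A A0 GA] := @gauss_primitive_near_limit R x x0; first lra.
pose sg := Num.min x (x * h / 2 / A).
have xh0 : 0 < x * h / 2 by rewrite divr_gt0// mulr_gt0.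
have sg0 : 0 < sg by rewrite lt_min x0 divr_gt0.
have sgx : sg <= x by rewrite ge_min lexx.
have sgA : (1 - x) * (Num.sqrt pi / 2) <= gauss_primitive (x * h / 2 / sg).
  rewrite (le_trans GA)// le_gauss_primitive// ler_pdivlMr// mulrC
    -ler_pdivlMr//.
  by rewrite ge_min lexx orbT.
pose e1 := Num.min (x * h / 2) (Num.min sg (x * h / 2 * sg ^+ 3 / 20)).
have e10 : 0 < e1.
  by rewrite lt_min xh0/= lt_min sg0/= divr_gt0// mulr_gt0// exprn_gt0.
move/cvgrPdist_lt : r0 => /(_ _ e10) r0.
move/cvgrPdist_lt : g_small => /(_ _ e10) g0.
near=> n.
have n1 : (1 <= n)%N by near: n; exact: nbhs_infty_ge.
have rn : `|r n| < e1 by have := near r0 n; rewrite sub0r normrN; apply.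
have gn : \big[Num.max/0]_(1 <= k < n.+1) `|g n k| < e1.
  have := near g0 n; rewrite sub0r normrN => /(_ _)/(le_lt_trans (ler_norm _));
    exact.
have [] := @survival_asymp _ _ _ (P n) (X n) n (g n) e1 n1 (X_indep n n1)
  (X_centered n)
  (X_variance n n1) (ltW e10) _ x sg _ x0 x1 sg0 sgx sgA _ _ _.
- apply: filterS (Xr n n1) => w Xw i /andP[i1 iN].
  apply: le_trans (ltW rn); apply: le_trans (ler_norm _); apply: le_trans Xw.
  by apply: (@le_bigmax_seq _ _ _ _ _ i) => //; rewrite mem_index_iota i1.
- move=> i /andP[i1 iN]; apply: le_trans (ltW gn).
  by apply: (@le_bigmax_seq _ _ _ _ _ i) => //; rewrite mem_index_iota i1.
- by rewrite ge_min lexx.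
- by rewrite ge_min; apply/orP; right; rewrite ge_min lexx.
- have : e1 <= x * h / 2 * sg ^+ 3 / 20.
    by rewrite ge_min; apply/orP; right; rewrite ge_min lexx orbT.
  by rewrite ler_pdivlMr// ler_pdivrMr ?exprn_gt0// mulrC.
apply: near_ratio1 => //.
have sn : (P n (survival n (X n) (g n)) \is a fin_num)%E.
  by rewrite fin_num_measure// survivalE; exact: measurable_stays.
by rewrite fine_gt0// survival_gt0//= ltey_eq sn.
Unshelve. all: by end_near.
Qed.
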